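(* Let $k$ be a field of characteristic different from $2$, let $G$ be a nonabelian torsion-free nilpotent group, and let $D$ be the (Ore) division ring of fractions of the group algebra $k[G]$. Let $\ast$ be a $k$-involution on $D$ which is induced by an involution of $G$. Then $D$ contains both a free symmetric pair and a free unitary pair with respect to $\ast$.
   Context: An involution on a group $G$ is an anti-automorphism of $G$ of order $2$. A $k$-involution on a $k$-algebra $R$ is a $k$-linear map $\ast$ with $(xy)^\ast=y^\ast x^\ast$ and $(x^\ast)^\ast=x$ for all $x,y\in R$. The $k$-linear extension of an involution of $G$ to $k[G]$ is a $k$-involution; a $k$-involution on a division ring $D$ generated by $k[G]$ is said to be induced by the involution of $G$ if it extends this $k$-involution of $k[G]$. (For $G$ torsion-free nilpotent, $k[G]$ is an Ore domain, so its division ring of fractions exists.) An element $x$ is symmetric if $x^\ast=x$ and unitary if $xx^\ast=x^\ast x=1$. Two elements $x,y$ form a free symmetric (resp. unitary) pair if both are symmetric (resp. unitary) and they generate a free noncyclic (i.e. free of rank $2$ on $x,y$) subgroup of the multiplicative group. *)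

(* Defs.v *)
From HB Require Import structures.
From mathcomp Require Import all_boot all_order all_algebra.
Set Implicit Arguments. Unset Strict Implicit. Unset Printing Implicit Defensive.
Import Order.TTheory GRing.Theory Num.Theory.
Local Open Scope ring_scope.

Definition is_group (G : Type) (mul : G -> G -> G) (one : G) (inv : G -> G) :=
  [/\ forall a b c, mul a (mul b c) = mul (mul a b) c,
      forall a, mul one a = a, forall a, mul a one = a,
      forall a, mul (inv a) a = one & forall a, mul a (inv a) = one].

Fixpoint gpow (G : Type) (mul : G -> G -> G) (one : G) (a : G) (n : nat) : G :=
  if n is n'.+1 then mul a (gpow mul one a n') else one.

Definition torsion_free (G : Type) (mul : G -> G -> G) (one : G) :=
  forall (a : G) (n : nat), (0 < n)%N -> gpow mul one a n = one -> a = one.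

Definition nonabelian (G : Type) (mul : G -> G -> G) :=
  exists a b, mul a b <> mul b a.

Definition gcomm (G : Type) (mul : G -> G -> G) (inv : G -> G) (a b : G) :=
  mul (mul (inv a) (inv b)) (mul a b).

Fixpoint upper_central (G : Type) (mul : G -> G -> G) (one : G) (inv : G -> G)
    (i : nat) (x : G) : Prop :=
  match i with
  | 0 => x = one
  | i'.+1 => forall y, upper_central mul one inv i' (gcomm mul inv x y)
  end.

Definition nilpotent (G : Type) (mul : G -> G -> G) (one : G) (inv : G -> G) :=
  exists c : nat, forall x, upper_central mul one inv c x.

Definition group_involution (G : Type) (mul : G -> G -> G) (f : G -> G) :=
  (forall a b, f (mul a b) = mul (f b) (f a)) /\ (forall a, f (f a) = a)
  /\ exists a, f a <> a.

Definition is_division_ring (D : unitRingType) :=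
  forall x : D, x != 0 -> x \is a GRing.unit.

Definition k_involution (k : fieldType) (D : unitAlgType k) (s : D -> D) :=
  [/\ forall (a : k) (x y : D), s (a *: x + y) = a *: s x + s y,
      forall x y : D, s (x * y) = s y * s x &
      forall x : D, s (s x) = x].

Definition in_group_algebra (k : fieldType) (D : unitAlgType k) (G : Type)
    (phi : G -> D) (d : D) :=
  exists (n : nat) (c : 'I_n -> k) (g : 'I_n -> G), d = \sum_(i < n) c i *: phi (g i).

(** The k-linear extension k[G] -> D of phi is injective. *)
Definition group_algebra_embedding (k : fieldType) (D : unitAlgType k) (G : Type)
    (phi : G -> D) :=
  forall (n : nat) (c : 'I_n -> k) (g : 'I_n -> G), injective g ->
    \sum_(i < n) c i *: phi (g i) = 0 -> forall i, c i = 0.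

Definition letter_eval (R : unitRingType) (x y : R) (l : bool * bool) : R :=
  let z := if l.1 then y else x in if l.2 then z^-1 else z.

Definition word_eval (R : unitRingType) (x y : R) (w : seq (bool * bool)) : R :=
  \prod_(l <- w) letter_eval x y l.

Fixpoint reduced_word (w : seq (bool * bool)) : bool :=
  match w with
  | l1 :: ((l2 :: _) as w') => ~~ ((l1.1 == l2.1) && (l1.2 != l2.2)) && reduced_word w'
  | _ => true
  end.

Definition free_pair (R : unitRingType) (x y : R) :=
  [/\ x \is a GRing.unit, y \is a GRing.unit &
      forall w : seq (bool * bool), w != [::] -> reduced_word w -> word_eval x y w != 1].

Definition free_symmetric_pair (R : unitRingType) (s : R -> R) (x y : R) :=
  [/\ s x = x, s y = y & free_pair x y].

Definition unitary (R : unitRingType) (s : R -> R) (x : R) :=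
  x * s x = 1 /\ s x * x = 1.

Definition free_unitary_pair (R : unitRingType) (s : R -> R) (x y : R) :=
  [/\ unitary s x, unitary s y & free_pair x y].

(* Main.v *)
Require Import Defs.
From HB Require Import structures.
From mathcomp Require Import all_boot all_order all_algebra.
From mathcomp Require Import zify ring.
From Stdlib Require Import Classical.
Set Implicit Arguments. Unset Strict Implicit. Unset Printing Implicit Defensive.
Import GRing.Theory.
Local Open Scope ring_scope.

(** Write * for the involution. Some a, b in G satisfy a b = c b a with c <> 1 central,
    a* = a^{+-1} and b* = b^{+-1}; their images X = b, Y = a, Z = c in D satisfy Y X = Z X Y,
    and the monomials Z^i X^j Y^l are linearly independent over k.

    For such a quantum plane, and polynomials N1, N2 over k that are coprime to N1(-t), N2(-t),
    the elements N1(X)/N1(-X) and N2(Y)/N2(-Y) generate a free group: a relation between them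
    can be specialized at Z = -1, because the skew polynomials in X, Y over k[Z] form an Ore
    domain in which factors Z + 1 cancel. There X and Y anticommute, and modulo N1(-t) the powers
    of N1(X)/N1(-X) become, up to scalars, the projections onto the parts that are even or odd
    in Y, so that no product alternating with powers of N2(Y)/N2(-Y) vanishes.

    With N = 1 - t the element N(x)/N(-x) is sent to its negative by x |-> x^-1, so its square is
    symmetric whether x* = x or x* = x^-1; it is unitary when x* = -x. With N = 1 + t - t^2 it is
    unitary when x* = x^-1. Replacing X and Y by suitable skew-symmetric elements of the quantum
    plane settles the unitary case for all actions of * on a and b. *)

(** * Skew polynomial rings *)

Section SkewPolynomials.
Variables (C : idomainType) (s : {rmorphism C -> C}).
Implicit Types (P Q R : {poly C}) (c : C).

(** Left multiplication by the variable y: moving y past a coefficient applies [s], and coefficients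
    are kept on the left. *)
Definition skshift Q : {poly C} := 'X * map_poly s Q.

(* The product of the skew polynomial ring C[y; s], in which y c = s(c) y. *)
Definition skmul P Q : {poly C} := \sum_(i < size P) P`_i *: iter i skshift Q.

Lemma skshift_is_zmod_morphism : zmod_morphism skshift.
Proof. by move=> P Q; rewrite /skshift rmorphB mulrBr. Qed.
HB.instance Definition _ :=
  GRing.isZmodMorphism.Build {poly C} {poly C} skshift skshift_is_zmod_morphism.

Lemma skshiftZ c Q : skshift (c *: Q) = s c *: skshift Q.
Proof. by rewrite /skshift linearZ /= -scalerAr. Qed.

Lemma iter_skshift0 i : iter i skshift 0 = 0.
Proof. by elim: i => //= i ->; rewrite raddf0. Qed.

Lemma iter_skshiftD i P Q : iter i skshift (P + Q) = iter i skshift P + iter i skshift Q.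
Proof. by elim: i => //= i ->; rewrite raddfD. Qed.

Lemma iter_skshiftZ i c Q : iter i skshift (c *: Q) = iter i s c *: iter i skshift Q.
Proof. by elim: i => //= i ->; rewrite skshiftZ. Qed.

Lemma coef_iter_skshift i Q n :
  (iter i skshift Q)`_n = if (n < i)%N then 0 else iter i s Q`_(n - i).
Proof.
elim: i n => [|i IH] n /=; first by rewrite subn0.
rewrite /skshift coefXM; case: n => [|n] //=.
by rewrite coef_map /= IH ltnS subSS; case: ifP; rewrite ?rmorph0.
Qed.

Lemma iter_skshift_polyXn i n : iter i skshift 'X^n = 'X^(i + n).
Proof. by elim: i => //= i ->; rewrite /skshift map_polyXn -exprS. Qed.

Lemma skmulE n P Q : (size P <= n)%N -> skmul P Q = \sum_(i < n) P`_i *: iter i skshift Q.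
Proof.
move=> le_Pn; rewrite /skmul (big_ord_widen n (fun i => P`_i *: iter i skshift Q)) //.
rewrite big_mkcond; apply: eq_bigr => i _; case: ltnP => // le_Pi.
by rewrite nth_default // scale0r.
Qed.

Lemma skmulDl P Q R : skmul (P + Q) R = skmul P R + skmul Q R.
Proof.
pose n := maxn (size P) (size Q).
rewrite !(@skmulE n) ?leq_maxl ?leq_maxr ?size_polyD // -big_split /=.
by apply: eq_bigr => i _; rewrite coefD scalerDl.
Qed.

Lemma skmulZl c P Q : skmul (c *: P) Q = c *: skmul P Q.
Proof.
rewrite !(@skmulE (size P)) ?size_scale_leq // scaler_sumr.
by apply: eq_bigr => i _; rewrite coefZ scalerA.
Qed.

Lemma skmulNl P Q : skmul (- P) Q = - skmul P Q.
Proof. by rewrite -scaleN1r skmulZl scaleN1r. Qed.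

Lemma skmulBl P Q R : skmul (P - Q) R = skmul P R - skmul Q R.
Proof. by rewrite skmulDl skmulNl. Qed.

Lemma skmul0l Q : skmul 0 Q = 0.
Proof. by rewrite /skmul size_poly0 big_ord0. Qed.

Lemma skmul0r P : skmul P 0 = 0.
Proof. by rewrite /skmul big1 // => i _; rewrite iter_skshift0 scaler0. Qed.

Lemma skmulDr P Q R : skmul P (Q + R) = skmul P Q + skmul P R.
Proof.
rewrite /skmul -big_split /=; apply: eq_bigr => i _.
by rewrite iter_skshiftD scalerDr.
Qed.

Lemma skmulCl c Q : skmul c%:P Q = c *: Q.
Proof.
rewrite (@skmulE 1) ?size_polyC ?leq_b1 // big_ord_recl big_ord0 addr0 /=.
by rewrite coefC.
Qed.

Lemma skmul1l Q : skmul 1 Q = Q.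
Proof. by rewrite skmulCl scale1r. Qed.

Lemma skmul_suml (I : Type) (r : seq I) (F : I -> {poly C}) Q :
  skmul (\sum_(i <- r) F i) Q = \sum_(i <- r) skmul (F i) Q.
Proof.
by elim/big_rec2: _ => [|i P1 P2 _ <-]; rewrite ?skmul0l ?skmulDl.
Qed.

(** The case of associativity with left factor y; [skmulA] follows by iterating it and summing. *)
Lemma skmul_shift P Q : skmul (skshift P) Q = skshift (skmul P Q).
Proof.
rewrite (@skmulE (size P).+1); last first.
  rewrite /skshift; apply: (leq_trans (size_polyMleq _ _)).
  by rewrite size_polyX /= ltnS size_poly.
rewrite big_ord_recl {1}/skshift coefXM /= scale0r add0r [in RHS]/skmul raddf_sum.
apply: eq_bigr => i _ /=; rewrite skshiftZ /bump /= add1n; congr (_ *: _).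
by rewrite /skshift coefXM coef_map.
Qed.

Lemma skmulA P Q R : skmul P (skmul Q R) = skmul (skmul P Q) R.
Proof.
rewrite [skmul P Q]/skmul skmul_suml {1}/skmul; apply: eq_bigr => i _; rewrite skmulZl; congr (_ *: _).
by elim: {i}(val i) => //= i ->; rewrite skmul_shift.
Qed.

Lemma skmulXn P n : skmul P 'X^n = P * 'X^n.
Proof.
rewrite -{2}[P]coefK poly_def mulr_suml; apply: eq_bigr => i _.
by rewrite iter_skshift_polyXn exprD scalerAl.
Qed.

Lemma skmul1r P : skmul P 1 = P.
Proof. by rewrite -(expr0 'X) skmulXn mulr1. Qed.
End SkewPolynomials.

(** * Absence of zero divisors and common right multiples in skew polynomial rings *)

Section SkewDomain.
Variables (C : idomainType) (s : {rmorphism C -> C}).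
Implicit Types (P Q R : {poly C}) (c : C).

Lemma skmulCr P c : skmul s P c%:P = \poly_(i < size P) (P`_i * iter i s c).
Proof.
rewrite poly_def; apply: eq_bigr => i _.
by rewrite -[c%:P]mul1r mulrC mul_polyC iter_skshiftZ (iter_skshift_polyXn _ _ 0) addn0 scalerA.
Qed.

Lemma coef_skmulCr P c i : (skmul s P c%:P)`_i = P`_i * iter i s c.
Proof. by rewrite skmulCr coef_poly; case: ltnP => // /(nth_default 0)->; rewrite mul0r. Qed.

(** The other terms have too small a degree to contribute. For injective [s] this rules out zero
    divisors. *)
Lemma coef_skmul_top P Q :
  (skmul s P Q)`_((size P).-1 + (size Q).-1)
    = lead_coef P * iter (size P).-1 s (lead_coef Q).
Proof.
have [->|nzP] := eqVneq P 0; first by rewrite skmul0l coef0 lead_coef0 mul0r.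
rewrite /skmul -(prednK (_ : 0 < size P)%N) ?size_poly_gt0 // big_ord_recr /= coefD coefZ.
rewrite coef_iter_skshift ltnNge leq_addr /= addKn -!lead_coefE.
rewrite coef_sum big1 ?add0r // => i _; rewrite coefZ coef_iter_skshift.
case: ifP => _; first by rewrite mulr0.
rewrite [Q`__]nth_default ?(iter_fix _ (rmorph0 s)) ?mulr0 //.
case: i => a /=; lia.
Qed.

Hypothesis s_inj : injective s.

Lemma iter_rmorph_eq0 n c : (iter n s c == 0) = (c == 0).
Proof.
elim: n => //= n <-; apply/eqP/eqP => [h|->]; last exact: rmorph0.
by apply: s_inj; rewrite h rmorph0.
Qed.

Lemma skmul_neq0 P Q : P != 0 -> Q != 0 -> skmul s P Q != 0.
Proof.
move=> nzP nzQ; apply/eqP => PQ0; move: (coef_skmul_top P Q); rewrite PQ0 coef0.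
by move/esym/eqP; rewrite mulf_eq0 iter_rmorph_eq0 !lead_coef_eq0 (negPf nzP) (negPf nzQ).
Qed.

Lemma skmulIr P Q R : R != 0 -> skmul s P R = skmul s Q R -> P = Q.
Proof.
move=> nzR eqPQ; apply/eqP; rewrite -subr_eq0; apply: contraTT isT => nz.
by have := skmul_neq0 nz nzR; rewrite skmulBl eqPQ subrr eqxx.
Qed.

(* s need not be onto (X |-> ZX on k[Z][X] is not); this weaker property is what the
   cancellation of leading terms needs. *)
Hypothesis s_onto : forall c, exists q u, [/\ u != 0, s u = u & s q = u * c].

(** The multipliers [u] are fixed by [s], so those of successive steps simply multiply. *)
Lemma iter_onto n c : exists q u, [/\ u != 0, s u = u & iter n s q = u * c].
Proof.
elim: n c => [|n IH] c; first by exists c, 1; rewrite oner_neq0 rmorph1 mul1r.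
have [q [u [nzu su sq]]] := s_onto c; have [q' [u' [nzu' su' sq']]] := IH q.
exists q', (u' * u); split; first by rewrite mulf_neq0.
  by rewrite rmorphM su su'.
by rewrite /= sq' rmorphM su' sq mulrA.
Qed.

Lemma iter_rmorphM n a b : iter n s (a * b) = iter n s a * iter n s b.
Proof. by elim: n => //= n ->; rewrite rmorphM. Qed.

(** A Euclidean descent: the leading term of the longer polynomial is cancelled against the shorter
    one, and a common multiple for the remainder yields one for the original pair. *)
Lemma skew_right_ore P Q : P != 0 -> Q != 0 ->
  exists A B, [/\ A != 0, B != 0 & skmul s P A = skmul s Q B].
Proof.
have [n] := ubnP (size P + size Q); elim: n P Q => // n IH P Q ltn nzP nzQ.
wlog leQP : P Q ltn nzP nzQ / (size Q <= size P)%N => [hw|].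
  have [/hw|/ltnW /hw] := leqP (size Q) (size P); first exact.
  by rewrite addnC => /(_ ltn nzQ nzP) [A [B [nzA nzB e]]]; exists B, A.
set m := (size P).-1; set r := (size Q).-1.
have szP : size P = m.+1 by rewrite prednK ?size_poly_gt0.
have szQ : size Q = r.+1 by rewrite prednK ?size_poly_gt0.
have lerm : (r <= m)%N by rewrite szP szQ in leQP.
have [g [u [nzu su hg]]] := iter_onto m (lead_coef Q).
have [g' [u' [nzu' su' hg']]] := iter_onto r (lead_coef P).
have fixu i : iter i s u = u by exact: iter_fix.
have fixu' i : iter i s u' = u' by exact: iter_fix.
(* By the choice of [g] and [g'], both P A0 and Q B0 have the coefficient u u' lead(P) lead(Q) in
   degree m, so their difference is shorter than P. *)
pose A0 : {poly C} := (g * u')%:P.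
pose B0 : {poly C} := (g' * u)%:P * 'X^(m - r).
have nz_of (a b : C) i c : b != 0 -> c != 0 -> iter i s a = b * c -> a != 0.
  by move=> nzb nzc h; rewrite -(iter_rmorph_eq0 i) h mulf_neq0.
have nzA0 : A0 != 0.
  by rewrite polyC_eq0 mulf_neq0 // (nz_of _ _ _ _ nzu _ hg) ?lead_coef_eq0.
have nzB0 : B0 != 0.
  rewrite mulf_neq0 ?polyC_eq0 ?monic_neq0 ?monicXn //.
  by rewrite mulf_neq0 // (nz_of _ _ _ _ nzu' _ hg') ?lead_coef_eq0.
pose P1 := skmul s P A0 - skmul s Q B0.
have szP1 : (size P1 <= m)%N.
  apply/leq_sizeP => j lemj; rewrite coefB coef_skmulCr.
  rewrite /B0 -(skmulXn s) skmulA skmulXn coefMXn ltnNge (leq_trans (leq_subr _ _) lemj) /=.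
  rewrite coef_skmulCr; move: lemj; rewrite leq_eqVlt => /predU1P[<-|ltmj].
    rewrite subKn // !iter_rmorphM hg hg' fixu fixu'.
    by rewrite -!lead_coefE; ring.
  rewrite nth_default ?szP // mul0r nth_default ?mul0r ?subrr // szQ.
  by lia.
have [P10|nzP1] := eqVneq P1 0.
  by exists A0, B0; split=> //; apply/eqP; rewrite -subr_eq0 -/P1 P10.
have [|A [B [nzA nzB eAB]]] := IH P1 Q _ nzP1 nzQ.
  by move: ltn szP1; rewrite szP; lia.
(* P1 A = Q B rearranges to P (A0 A) = Q (B0 A + B). *)
exists (skmul s A0 A), (skmul s B0 A + B).
have eq1 : skmul s P (skmul s A0 A) = skmul s Q (skmul s B0 A + B).
  by rewrite skmulDr -eAB /P1 skmulBl !skmulA addrC subrK.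
split=> //; first exact: skmul_neq0.
apply: contra_eq_neq eq1 => ->; rewrite skmul0r.
by apply: skmul_neq0 => //; apply: skmul_neq0.
Qed.
End SkewDomain.

(** * Change of coefficients and evaluation of skew polynomials *)

Section SkewMorphisms.
Variables (C : idomainType) (s : {rmorphism C -> C}).

(** [rho] will be the specialization at Z = -1. The image of P may be shorter than P, so its product
    is expanded over the longer range. *)
Lemma map_skmul (C' : idomainType) (s' : {rmorphism C' -> C'}) (rho : {rmorphism C -> C'})
    (rhos : forall c, rho (s c) = s' (rho c)) (P Q : {poly C}) :
  map_poly rho (skmul s P Q) = skmul s' (map_poly rho P) (map_poly rho Q).
Proof.
have shE R : map_poly rho (skshift s R) = skshift s' (map_poly rho R).
  rewrite /skshift rmorphM /= map_polyX; congr (_ * _).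
  by apply/polyP => i; rewrite !coef_map /= rhos.
rewrite [RHS](@skmulE _ _ (size P)) ?size_poly // /skmul rmorph_sum; apply: eq_bigr => i _ /=.
rewrite linearZ /= coef_map; congr (_ *: _).
by elim: {i}(val i) => //= i IH; rewrite shE IH.
Qed.

Variables (A : nzRingType) (psi : {rmorphism C -> A}) (y : A).
Hypothesis y_psi : forall c, y * psi c = psi (s c) * y.

(** Coefficients stand to the left of the powers of [y]; given [y_psi], this is the homomorphism
    provided by the universal property of the skew polynomial ring. *)
Definition skeval (P : {poly C}) : A := (map_poly psi P).[y].

Lemma skevalD P Q : skeval (P + Q) = skeval P + skeval Q.
Proof. by rewrite /skeval rmorphD hornerD. Qed.

Lemma skevalC c : skeval c%:P = psi c.
Proof. by rewrite /skeval map_polyC hornerC. Qed.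

Lemma skevalZ c P : skeval (c *: P) = psi c * skeval P.
Proof. by rewrite /skeval linearZ hornerZ. Qed.

Lemma skeval_shift P : skeval (skshift s P) = y * skeval P.
Proof.
rewrite /skeval /skshift rmorphM /= map_polyX -commr_polyX hornerMX.
elim/poly_ind: P => [|P c IH]; first by rewrite !rmorph0 !horner0 mul0r mulr0.
rewrite !rmorphD !rmorphM /= !map_polyX !map_polyC !hornerMXaddC mulrDl mulrDr /= y_psi.
by rewrite IH mulrA.
Qed.

Lemma skevalM P Q : skeval (skmul s P Q) = skeval P * skeval Q.
Proof.
rewrite {2}/skeval (@horner_coef_wide _ (size P)) ?size_poly // mulr_suml.
rewrite /skeval rmorph_sum horner_sum; apply: eq_bigr => i _.
rewrite /= linearZ hornerZ coef_map -mulrA; congr (_ * _); rewrite -!/(skeval _).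
by elim: {i}(val i) => [|i IH] /=; rewrite ?mul1r // skeval_shift IH exprS mulrA.
Qed.
End SkewMorphisms.

(** * Specialization of the quantum plane at Z = -1 *)

Lemma coef_comp_scaleX (R : comNzRingType) (c : R) (p : {poly R}) i :
  (p \Po (c%:P * 'X))`_i = p`_i * c ^+ i.
Proof.
elim/poly_ind: p i => [|p a IH] i; first by rewrite comp_poly0 !coef0 mul0r.
rewrite comp_polyD comp_polyM comp_polyX comp_polyC mulrCA.
rewrite !coefD coefCM !coefC !coefMX.
by case: i => [|i] /=; rewrite ?IH ?mulr0 ?expr0 ?mulr1 ?addr0 // exprS mulrCA.
Qed.

Section Specialization.
Variable k : fieldType.
Local Notation kt := {poly k}.
Local Notation kzx := {poly {poly k}}.

(* In k[Z][X] the inner variable is Z. *)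
Definition qtwist : {rmorphism kzx -> kzx} := comp_poly ('X%:P * 'X).
(** What [qtwist] becomes at Z = -1. *)
Definition ntwist : {rmorphism kt -> kt} := comp_poly (- 'X).
Definition atN1 : {rmorphism kzx -> kt} := map_poly (horner_eval (-1)).

Lemma coef_ntwist (p : kt) i : (ntwist p)`_i = p`_i * (-1) ^+ i.
Proof. by rewrite /ntwist /= -[- 'X]mulN1r -polyC1 -polyCN coef_comp_scaleX. Qed.

Lemma coef_qtwist (p : kzx) i : (qtwist p)`_i = p`_i * 'X^i.
Proof. exact: coef_comp_scaleX. Qed.

Lemma ntwistK : involutive ntwist.
Proof. by move=> p; apply/polyP => i; rewrite !coef_ntwist -mulrA -exprMn mulrNN mulr1 expr1n mulr1. Qed.

Lemma ntwist_inj : injective ntwist.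
Proof. exact: inv_inj ntwistK. Qed.

Lemma qtwist_inj : injective qtwist.
Proof.
move=> p q /polyP e; apply/polyP => i; move: (e i); rewrite !coef_qtwist.
by apply: mulIf; rewrite monic_neq0 ?monicXn.
Qed.

(** Multiplying by Z^n, with n = [size c], leaves room to divide the coefficient of X^i by Z^i,
    which [qtwist] restores. Z^n does not involve X, hence is fixed. *)
Lemma qtwist_onto (c : kzx) : exists q u, [/\ u != 0, qtwist u = u & qtwist q = u * c].
Proof.
exists (\poly_(i < size c) (c`_i * 'X^(size c - i))), ('X^(size c))%:P.
split; first by rewrite polyC_eq0 monic_neq0 ?monicXn.
  by rewrite /qtwist /= comp_polyC.
apply/polyP => i; rewrite coef_qtwist coef_poly coefCM; case: ltnP => lti.
  by rewrite -mulrA -exprD subnK 1?mulrC // ltnW.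
by rewrite nth_default // mul0r mulr0.
Qed.

Lemma atN1_qtwist p : atN1 (qtwist p) = ntwist (atN1 p).
Proof.
rewrite /atN1 /qtwist /ntwist /= map_comp_poly rmorphM /= map_polyC map_polyX /=.
by rewrite /horner_eval hornerX polyCN mulN1r.
Qed.

(** The factor theorem at Z = -1, one coefficient of X at a time. *)
Lemma atN1_eq0 p : atN1 p = 0 -> exists q, p = ('X + 1)%:P * q.
Proof.
elim/poly_ind: p => [_|p c IH]; first by exists 0; rewrite mulr0.
rewrite rmorphD rmorphM /= map_polyX map_polyC => /polyP e.
have [|q ->] := IH.
  by apply/polyP => i; move: (e i.+1); rewrite coefD coefMX coefC /= addr0 !coef0.
have /factor_theorem[r ->] : root c (-1).
  by move: (e 0); rewrite coefD coefMX coefC /= add0r coef0 => /eqP.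
exists (q * 'X + r%:P); rewrite [RHS]mulrDr mulrA -polyCM; congr (_ + _).
by rewrite polyCN polyC1 opprK mulrC.
Qed.

Lemma map_atN1_eq0 (P : {poly kzx}) :
  map_poly atN1 P = 0 -> exists Q, P = ('X + 1)%:P *: Q.
Proof.
elim/poly_ind: P => [_|P c IH]; first by exists 0; rewrite scaler0.
rewrite rmorphD rmorphM /= map_polyX map_polyC => /polyP e.
have [|Q ->] := IH.
  by apply/polyP => i; move: (e i.+1); rewrite coefD coefMX coefC /= addr0 !coef0.
have [|r ->] := @atN1_eq0 c.
  by move: (e 0); rewrite coefD coefMX coefC /= add0r coef0.
by exists (Q * 'X + r%:P); rewrite scalerDr scalerAl -!mul_polyC -polyCM.
Qed.

Local Notation tmul := (skmul qtwist).
Local Notation bmul := (skmul ntwist).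
Local Notation red := (map_poly atN1).

Lemma redM P Q : red (tmul P Q) = bmul (red P) (red Q).
Proof. exact: map_skmul atN1_qtwist P Q. Qed.

(* Both cofactors of a common multiple are divisible by Z + 1 as soon as one is. *)
Lemma right_ore_at_N1 P Q : red P != 0 -> red Q != 0 ->
  exists A B, [/\ red A != 0, red B != 0 & tmul P A = tmul Q B].
Proof.
move=> nzP nzQ.
have nz0 (R : {poly kzx}) : red R != 0 -> R != 0.
  by apply: contraNneq => ->; rewrite rmorph0.
have [A [B [nzA _ eAB]]] := skew_right_ore qtwist_inj qtwist_onto (nz0 _ nzP) (nz0 _ nzQ).
(* Descent on the degree in Z of the top coefficient of A, which each removed factor Z + 1 lowers by
   one. *)
have [n] := ubnP (size (lead_coef (lead_coef A))).
elim: n A B nzA eAB => // n IH A B nzA eAB ltn.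
have eqr : bmul (red P) (red A) = bmul (red Q) (red B) by rewrite -!redM eAB.
have [A0|nzrA] := eqVneq (red A) 0; last first.
  exists A, B; split=> //; apply: contra_eq_neq eqr => ->; rewrite skmul0r.
  exact: skmul_neq0 ntwist_inj _ _ nzP nzrA.
have B0 : red B = 0.
  apply/eqP; apply: contra_eqT eqr => nzB; rewrite A0 skmul0r eq_sym.
  exact: skmul_neq0 ntwist_inj _ _ nzQ nzB.
have [A' eA] := map_atN1_eq0 A0; have [B' eB] := map_atN1_eq0 B0.
pose w : kzx := ('X + 1)%:P.
have szw : size ('X + 1 : {poly k}) = 2 by rewrite -[1]opprK -polyC1 -polyCN size_XsubC.
have nzw0 : ('X + 1 : {poly k}) != 0 by rewrite -size_poly_eq0 szw.
have nzw : w != 0 by rewrite polyC_eq0.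
(* Z + 1 is central, being fixed by [qtwist]. *)
have cw R S : tmul R (w *: S) = w *: tmul R S.
  rewrite -!(skmulCl qtwist) !skmulA; congr (tmul _ S); apply/polyP => i.
  rewrite coef_skmulCr skmulCl coefZ mulrC; congr (_ * _).
  by apply: iter_fix; rewrite /qtwist /= comp_polyC.
apply: (IH A' B').
- by apply: contraNneq nzA => A'0; rewrite eA A'0 scaler0.
- by apply: (@mulfI _ w%:P); rewrite ?polyC_eq0 // !mul_polyC -!cw -eA -eB.
- have nzA' : A' != 0 by apply: contraNneq nzA => A'0; rewrite eA A'0 scaler0.
  have := ltn; rewrite eA lead_coefZ lead_coefM lead_coefC mulrC size_Mmonic ?lead_coef_eq0 //.
    by rewrite szw addn2.
  by rewrite -[1]opprK -polyC1 -polyCN monicXsubC.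
Qed.
End Specialization.

(** * Ping-pong at Z = -1 *)

Section PingPong.
Variable k : fieldType.
Hypothesis k2 : (2 : k) != 0.
Local Notation kt := {poly k}.
Local Notation nt := (ntwist k).
Local Notation bmul := (skmul nt).

Lemma iter_ntwist i (c : kt) : iter i nt c = if odd i then nt c else c.
Proof. by elim: i => //= i ->; case: (odd i); rewrite //= ntwistK. Qed.

Lemma ntwistC (c : k) : nt c%:P = c%:P.
Proof. exact: comp_polyC. Qed.

(** The coefficients of [g ^:P] are constants, which the twist fixes. *)
Lemma bmul_liftr (P : {poly kt}) (g : kt) : bmul P (g ^:P) = P * g ^:P.
Proof.
elim/poly_ind: g => [|g c IH]; first by rewrite map_poly0 skmul0r mulr0.
rewrite rmorphD rmorphM /= map_polyX map_polyC /= skmulDr mulrDr; congr (_ + _).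
  by rewrite -['X]expr1 mulrA -IH -!(skmulXn nt) skmulA.
apply/polyP => i; rewrite coef_skmulCr coefMC; congr (_ * _).
by apply: iter_fix; exact: ntwistC.
Qed.

(** Otherwise p would divide q^n, to which it is coprime. *)
Lemma coprime_expn_neq (p q : kt) (c : k) n :
  coprimep p q -> (1 < size p)%N -> (0 < n)%N -> c != 0 -> p ^+ n <> c *: q ^+ n.
Proof.
move=> copq szp n0 nzc e.
have : p %| q ^+ n by rewrite -(dvdpZr _ _ nzc) -e -(prednK n0) exprS dvdp_mulr.
rewrite -[q ^+ n]mulr1 Gauss_dvdpr ?coprimep_expr // dvdp1 => /eqP sz1.
by rewrite sz1 in szp.
Qed.

(** Applied below to polynomials in y with constant coefficients; [true] means odd. *)
Definition parity (j : bool) (h : kt) := forall i, odd i != j -> h`_i = 0.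

Definition part (j : bool) (h : kt) : kt := \poly_(i < size h) (if odd i == j then h`_i else 0).

Lemma coef_part j h i : (part j h)`_i = if odd i == j then h`_i else 0.
Proof.
by rewrite coef_poly; case: ltnP => // le_hi; rewrite [h`_i]nth_default ?if_same.
Qed.

Lemma parity_part j h : parity j (part j h).
Proof. by move=> i /negPf ne; rewrite coef_part ne. Qed.

Lemma parity_ntwist j h : parity j h -> nt h = (-1) ^+ j *: h.
Proof.
move=> par; apply/polyP => i; rewrite coef_ntwist coefZ -signr_odd mulrC.
by have [->//|/par->] := eqVneq (odd i) j; rewrite !mulr0.
Qed.

Lemma part_eq0 j h : part j h = 0 -> parity (~~ j) h.
Proof.
move=> /polyP e i; have := e i; rewrite coef_part coef0.
by clear e; case: (odd i) j => [] [].
Qed.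

Variables N1 N2 : kt.
Hypotheses (co1 : coprimep N1 (nt N1)) (sz1 : (1 < size N1)%N).
Hypotheses (co2 : coprimep N2 (nt N2)) (sz2 : (1 < size N2)%N).

Definition sgn_twist (e : bool) (p : kt) : kt := if e then nt p else p.

(** Over the denominator N(t) N(-t), the letter N(t)/N(-t) has numerator N(t)^2 and its inverse has
    N(-t)^2. This denominator is even, hence central when x and y anticommute. *)
Definition letter_num (l : bool * bool) : {poly kt} :=
  if l.1 then (sgn_twist l.2 N2 ^+ 2) ^:P else (sgn_twist l.2 N1 ^+ 2)%:P.

Definition letter_den (l : bool * bool) : {poly kt} :=
  if l.1 then (N2 * nt N2) ^:P else (N1 * nt N1)%:P.

Definition word_num (w : seq (bool * bool)) := foldr (fun l => bmul (letter_num l)) 1 w.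
Definition word_den (w : seq (bool * bool)) := foldr (fun l => bmul (letter_den l)) 1 w.

Lemma letter_den_central l P : bmul (letter_den l) P = bmul P (letter_den l).
Proof.
case: l => [[] d]; rewrite /letter_den /=; last first.
  apply/polyP => i; rewrite skmulCl coef_skmulCr coefZ iter_ntwist mulrC.
  by rewrite rmorphM /= ntwistK [nt N1 * _]mulrC if_same.
pose G := N2 * nt N2; rewrite -/G.
(* A polynomial invariant under t |-> -t has no odd terms because 2 is nonzero; even powers of y
   commute with all coefficients. *)
have odd0 i : odd i -> G`_i = 0.
  move=> oddi; have : (nt G)`_i = G`_i by rewrite rmorphM /= ntwistK mulrC.
  rewrite coef_ntwist -signr_odd oddi mulrN1 => /eqP.
  by rewrite eq_sym -addr_eq0 -mulr2n -mulr_natl mulf_eq0 (negPf k2) => /eqP.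
rewrite bmul_liftr -[in RHS](coefK (G ^:P)) poly_def mulr_sumr /skmul.
apply: eq_bigr => i _; rewrite coef_map -scalerAr /=.
case: (boolP (odd i)) => [/odd0->|even_i]; first by rewrite !scale0r.
congr (_ *: _); apply/polyP => n.
by rewrite coef_iter_skshift coefMXn iter_ntwist (negPf even_i).
Qed.

Lemma size_ntwist (p : kt) : size (nt p) = size p.
Proof.
have le (q : kt) : (size (nt q) <= size q)%N.
  by apply/leq_sizeP => j lej; rewrite coef_ntwist nth_default ?mul0r.
by apply/eqP; rewrite eqn_leq le -{1}[p]ntwistK le.
Qed.

Lemma coprime_sgn_twist e : coprimep (sgn_twist e N2) (nt (sgn_twist e N2)).
Proof. by case: e; rewrite /= ?ntwistK // coprimep_sym. Qed.

(* Modulo N1(-t) the two letters over x are the projections onto the parts of a given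
   parity in y, and the letters over y have coefficients in k. *)
Definition shape (l : bool * bool) (h : kt) : Prop :=
  if l.1 then exists g m j, [/\ g != 0, parity j g & h = g * sgn_twist l.2 N2 ^+ m.+1.*2]
  else h != 0 /\ parity l.2 h.

(** The ping-pong invariant: modulo N1(-t), P is N1^a h(y), with h over k of the shape left by the
    last letter [l]. *)
Definition pp_state (l : bool * bool) (P : {poly kt}) : Prop :=
  exists a h, shape l h /\ forall i, nt N1 %| P`_i - h`_i *: N1 ^+ a.

Lemma shape_neq0 l h : shape l h -> h != 0.
Proof.
case: l => [[] e] /= [] // g [m [j [nzg _ ->]]]; rewrite mulf_neq0 // expf_neq0 //.
by rewrite -size_poly_gt0; case: e; rewrite /sgn_twist ?size_ntwist ltnW.
Qed.

(** After a letter over x, the hypothesis on letters makes the part all of h. After a letter over y,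
    h = g N^n with g of one parity; if h had one parity as well, N(-t)^n would be a multiple of
    N(t)^n, against coprimality. *)
Lemma part_neq0 l e h : shape l h -> ~~ ((l.1 == false) && (l.2 != e)) -> part e h != 0.
Proof.
case: l => [[] d] /=; last first.
  move=> [nzh parh]; rewrite negbK => /eqP <-; suff -> : part d h = h by [].
  apply/polyP => i; rewrite coef_part; case: ifPn => // ne.
  by rewrite parh.
move=> [g [m [j [nzg parg ->]]]] _; apply/eqP => /part_eq0 /parity_ntwist.
rewrite rmorphM rmorphXn /= (parity_ntwist parg) -scalerAl.
set N := sgn_twist d N2; set n := m.+1.*2 => /(congr1 (fun p => (-1) ^+ j *: p)).
rewrite !scalerA -!signr_addb addbb scale1r scalerAr => /(mulfI nzg) eN.
apply: (@coprime_expn_neq (nt N) N ((-1) ^+ (j (+) ~~ e)) n _ _ _ _ eN) => //.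
- by rewrite coprimep_sym; exact: coprime_sgn_twist.
- by rewrite size_ntwist /N; case: (d); rewrite /= ?size_ntwist.
- by rewrite signr_eq0.
Qed.

(** A letter over y multiplies h by N2(y)^2 or N2(-y)^2. A letter over x multiplies the coefficient
    of y^i by N1(t)^2 or N1(-t)^2 according to the parity of i, so modulo N1(-t) one part of h
    survives and [a] grows by 2. *)
Lemma pp_step l l' P : pp_state l P -> ~~ ((l.1 == l'.1) && (l.2 != l'.2)) ->
  pp_state l' (bmul P (letter_num l')).
Proof.
move=> [a [h [shh eP]]]; case: l' => [[] e] /= red.
  exists a, (h * sgn_twist e N2 ^+ 2); split.
    case: l shh red => [[] d] /=; last by move=> [nzh parh] _; exists h, 0, d.
    move=> [g [m [j [nzg parg ->]]]]; rewrite negbK => /eqP <-.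
    by exists g, m.+1, j; split; rewrite // -mulrA -exprD addn2.
  move=> i; rewrite /letter_num /= bmul_liftr !coefM scaler_suml -sumrB.
  apply: (big_ind (fun p => nt N1 %| p)) => [|p q|j _]; first exact: dvdp0.
    exact: dvdp_add.
  rewrite coef_map /= [_ * _%:P]mulrC mul_polyC [h`_j * _]mulrC -scalerA -scalerBr.
  by rewrite -[_ *: (_ - _)]mul_polyC dvdp_mull.
exists a.+2, (part e h); split; first by split; [exact: part_neq0 shh red|exact: parity_part].
move=> i; rewrite /letter_num /= coef_skmulCr iter_ntwist coef_part.
have -> : (if odd i then nt (sgn_twist e N1 ^+ 2) else sgn_twist e N1 ^+ 2)
    = sgn_twist (odd i != e) N1 ^+ 2.
  by rewrite rmorphXn; case: (odd i); case: (e); rewrite /= ?ntwistK.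
case: eqP => _ /=; last by rewrite scale0r subr0 expr2 !dvdp_mull.
by rewrite -[a.+2]addn2 exprD scalerAl -mulrBl dvdp_mulr //; exact: eP.
Qed.

Lemma pp_run w l P : pp_state l P -> reduced_word (l :: w) ->
  exists l', pp_state l' (bmul P (word_num w)).
Proof.
elim: w l P => [|l' w IH] l P st; first by exists l; rewrite /= skmul1r.
case/andP=> red redw; have [l'' h] := IH _ _ (pp_step st red) redw.
by exists l''; rewrite /= skmulA.
Qed.

(** A letter over x makes the denominator divisible by N1(-t). By [pp_run] the numerator, multiplied
    by a suitable [h0], has modulo N1(-t) a coefficient that is a nonzero constant times N1^a, and
    N1 is coprime to N1(-t). *)
Lemma word_num_neq_den w : reduced_word w -> has (fun l => ~~ l.1) w ->
  word_num w <> word_den w.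
Proof.
move=> redw hasu e.
have [l [h0 [st redlw]]] : exists l h0, pp_state l h0 /\ reduced_word (l :: w).
  case: w redw hasu {e} => // l0 w red _.
  (* A fictitious letter over x precedes the word, with its parity chosen so that the first actual
     letter does not cancel it. *)
  pose e := ~~ l0.1 && l0.2; exists (false, e), ('X^e); split.
    exists 0, 'X^e; split=> /=; first split.
    - by rewrite monic_neq0 ?monicXn.
    - by move=> i; rewrite coefXn; case: e; case: i => [|[|i]].
    by move=> i; rewrite expr0 !coefXn alg_polyC; case: eqP; rewrite ?subrr // dvdp0.
  by move: red => /= ->; rewrite andbT /e /=; case: (l0) => [[] []].
have [l' [a [h [/shape_neq0 nzh dv]]]] := pp_run st redlw.
(* A central factor N1(x) N1(-x) is moved to the front of the denominator. *)
have [Q eQ] : exists Q, word_den w = bmul (N1 * nt N1)%:P Q.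
  elim: w hasu {redw redlw e dv} => //= l1 w IH.
  case: l1 => [[] d] /=; last by exists (word_den w).
  move=> /IH[Q ->]; exists (bmul (letter_den (true, d)) Q).
  by rewrite !skmulA; congr (bmul _ Q); exact: letter_den_central.
have dvden i : nt N1 %| (bmul h0 (word_den w))`_i.
  rewrite eQ skmulA -(letter_den_central (false, false)) -skmulA skmulCl coefZ.
  by rewrite dvdp_mulr // dvdp_mull.
have [i nzi] : exists i, h`_i != 0.
  by exists (size h).-1; rewrite -lead_coefE lead_coef_eq0.
have := dv i; rewrite e dvdp_subr // dvdpZr // -[N1 ^+ a]mulr1 Gauss_dvdpr.
  by rewrite dvdp1 size_ntwist => /eqP sz; move: sz1; rewrite sz.
by rewrite coprimep_expr // coprimep_sym.
Qed.
End PingPong.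

(** * Free pairs in a quantum plane *)

Lemma comm_horner_alg (k : fieldType) (A : unitAlgType k) (a b : A) (p : {poly k}) :
  GRing.comm a b -> GRing.comm a (horner_alg b p).
Proof.
move=> cab; elim/poly_ind: p => [|p c IH]; first by rewrite rmorph0; exact: commr0.
rewrite rmorphD rmorphM /= horner_algX horner_algC.
by apply: commrD; [exact: commrM|rewrite /GRing.comm mulr_algr mulr_algl].
Qed.

Section QuantumPlane.
Variables (k : fieldType) (D : unitAlgType k).
Local Notation kzx := {poly {poly k}}.
Local Notation nt := (ntwist k).

(** Coefficients stand on the left, so monomials are evaluated in the order Z^i X^j Y^l. *)
Definition qeval (X Y Z : D) (P : {poly kzx}) : D :=
  (map_poly (fun c : kzx => (map_poly (horner_alg Z) c).[X]) P).[Y].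

(** The last clause is the linear independence over k of the ordered monomials. *)
Definition quantum_plane (X Y Z : D) :=
  [/\ GRing.comm X Z, GRing.comm Y Z, Y * X = Z * X * Y &
      forall P, qeval X Y Z P = 0 -> P = 0].

(** In a division ring, passing from a to -a inverts this element. If N(-a) = 0 its value is 0,
    because 0^-1 = 0. *)
Definition odd_ratio (N : {poly k}) (a : D) : D := horner_alg a N / horner_alg a (nt N).

Hypothesis k2 : (2 : k) != 0.
Hypothesis divD : is_division_ring D.
Variables X Y Z : D.
Hypothesis qXYZ : quantum_plane X Y Z.

Let cXZ : GRing.comm X Z. Proof. by case: qXYZ. Qed.
Let cYZ : GRing.comm Y Z. Proof. by case: qXYZ. Qed.
Let YX : Y * X = Z * X * Y. Proof. by case: qXYZ. Qed.

Let cXp : commr_rmorph (horner_alg Z) X.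
Proof. by move=> p; exact: comm_horner_alg cXZ. Qed.

Let psi : {rmorphism kzx -> D} := horner_morph cXp.
Local Notation ev := (skeval psi Y).
Local Notation red := (map_poly (atN1 k)).
Local Notation tmul := (skmul (qtwist k)).
Local Notation bmul := (skmul nt).

Lemma ev_inj : injective ev.
Proof.
move=> P Q e; apply/eqP; rewrite -subr_eq0; apply/eqP.
case: qXYZ => _ _ _; apply; rewrite -[LHS]/(ev (P - Q)).
by rewrite -[- Q]scaleN1r skevalD skevalZ rmorphN1 mulN1r e subrr.
Qed.

Lemma psiX : psi 'X = X.
Proof. by rewrite /psi /= /horner_morph map_polyX hornerX. Qed.

Lemma psiC c : psi c%:P = horner_alg Z c.
Proof. by rewrite /psi /= /horner_morph map_polyC hornerC. Qed.

Lemma Y_psi c : Y * psi c = psi (qtwist k c) * Y.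
Proof.
elim/poly_ind: c => [|p c IH]; first by rewrite !rmorph0 mul0r mulr0.
have tX : qtwist k 'X = 'X%:P * 'X by rewrite /qtwist /= comp_polyX.
have tC : qtwist k c%:P = c%:P by rewrite /qtwist /= comp_polyC.
rewrite !rmorphD !rmorphM /= tX tC rmorphM !psiX !psiC horner_algX mulrDr mulrDl.
rewrite (comm_horner_alg c cYZ); congr (_ + _).
by rewrite mulrA IH -mulrA YX -!mulrA.
Qed.

Lemma evM P Q : ev (tmul P Q) = ev P * ev Q.
Proof. exact: skevalM Y_psi P Q. Qed.

Lemma ev_neq0 P : P != 0 -> ev P != 0.
Proof.
apply: contraNneq => e; apply/eqP/ev_inj; rewrite e.
by rewrite /skeval rmorph0 horner0.
Qed.

Lemma red_neq0 P : red P != 0 -> P != 0.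
Proof. by apply: contraNneq => ->; rewrite rmorph0. Qed.

(* d is the fraction N / M of skew polynomials, and its value at Z = -1 is the fraction
   S / del (del will be central). *)
Definition specializes (d : D) (S del : {poly {poly k}}) :=
  exists M N, [/\ red M != 0, red N != 0, d * ev M = ev N & bmul S (red M) = bmul del (red N)].

Lemma specializes_ratio A B S del : red A != 0 -> red B != 0 ->
  bmul S (red B) = bmul del (red A) -> specializes (ev A / ev B) S del.
Proof.
by move=> nzA nzB e; exists B, A; split=> //; rewrite divrK // divD ?ev_neq0 ?red_neq0.
Qed.

(** The fractions N/M and N'/M' multiply to (N B)/(M' A) where N' A = M B. The cofactors A and B are
    chosen nonzero at Z = -1, so the new fraction still specializes. *)
Lemma specializesM d S del d' S' del' : (forall P, bmul del' P = bmul P del') ->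
  specializes d S del -> specializes d' S' del' ->
  specializes (d * d') (bmul S S') (bmul del del').
Proof.
move=> cen [M [N [nzM nzN eD eS]]] [M' [N' [nzM' nzN' eD' eS']]].
have [A [B [nzA nzB eAB]]] := right_ore_at_N1 nzN' nzM.
have eAB' : bmul (red N') (red A) = bmul (red M) (red B) by rewrite -!redM eAB.
exists (tmul M' A), (tmul N B); rewrite !redM; split.
- exact: skmul_neq0 (@ntwist_inj k) _ _ nzM' nzA.
- exact: skmul_neq0 (@ntwist_inj k) _ _ nzN nzB.
- by rewrite !evM -mulrA (mulrA d') eD' -(evM N') eAB evM mulrA eD.
- rewrite !skmulA -(skmulA _ S) eS' (skmulA _ S) -cen -!skmulA eAB'.
  by rewrite (skmulA _ S) eS !skmulA cen.
Qed.

(** Here M = N since evaluation is injective, and its nonzero reduction cancels. A relation in D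
    thus becomes an equation at Z = -1. *)
Lemma specializes1 S del : specializes 1 S del -> S = del.
Proof.
move=> [M [N [nzM nzN]]]; rewrite mul1r => /ev_inj <-.
exact: skmulIr (@ntwist_inj k) _ _ _ nzM.
Qed.

Variables N1 N2 : {poly k}.
Hypotheses (co1 : coprimep N1 (nt N1)) (sz1 : (1 < size N1)%N).
Hypotheses (co2 : coprimep N2 (nt N2)) (sz2 : (1 < size N2)%N).

(** The two copies of k[t] in the skew polynomial ring, in the variables X and Y. *)
Let xlift (N : {poly k}) : {poly kzx} := (N ^:P)%:P.
Let ylift (N : {poly k}) : {poly kzx} := map_poly polyC (N ^:P).

Lemma ev_xlift N : ev (xlift N) = horner_alg X N.
Proof.
rewrite skevalC /psi /= /horner_morph -map_poly_comp; congr (_.[_]).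
by apply: eq_map_poly => c /=; rewrite horner_algC.
Qed.

Lemma ev_ylift N : ev (ylift N) = horner_alg Y N.
Proof.
rewrite /skeval -!map_poly_comp; congr (_.[_]).
by apply: eq_map_poly => c /=; rewrite -[LHS]/(psi _) psiC horner_algC.
Qed.

Lemma red_xlift N : red (xlift N) = N%:P.
Proof.
rewrite map_polyC /= /atN1 /= -map_poly_comp map_poly_id // => c _ /=.
by rewrite /horner_eval hornerC.
Qed.

Lemma red_ylift N : red (ylift N) = N ^:P.
Proof.
rewrite -!map_poly_comp; apply: eq_map_poly => c /=.
by rewrite /atN1 /= map_polyC /= /horner_eval hornerC.
Qed.

Let u := odd_ratio N1 X.
Let v := odd_ratio N2 Y.

Lemma nz_sgn_twist e (N : {poly k}) : (1 < size N)%N -> sgn_twist e N != 0.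
Proof.
by move=> sz; rewrite -size_poly_gt0; case: e; rewrite /sgn_twist ?size_ntwist ltnW.
Qed.

Lemma specializes_letter l :
  specializes (letter_eval u v l) (letter_num N1 N2 l) (letter_den N1 N2 l).
Proof.
have unitE (R : {poly kzx}) : red R != 0 -> ev R \is a GRing.unit.
  by move=> nzR; rewrite divD ?ev_neq0 ?red_neq0.
have invE R R' : red R != 0 -> red R' != 0 -> (ev R / ev R')^-1 = ev R' / ev R.
  by move=> nzR nzR'; rewrite invrM ?unitrV ?invrK ?unitE.
have nzx e : red (xlift (sgn_twist e N1)) != 0 by rewrite red_xlift polyC_eq0 nz_sgn_twist.
have nzy e : red (ylift (sgn_twist e N2)) != 0.
  by rewrite red_ylift map_polyC_eq0 nz_sgn_twist.
have -> : letter_eval u v l = if l.1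
    then ev (ylift (sgn_twist l.2 N2)) / ev (ylift (sgn_twist (~~ l.2) N2))
    else ev (xlift (sgn_twist l.2 N1)) / ev (xlift (sgn_twist (~~ l.2) N1)).
  rewrite /letter_eval /u /v /odd_ratio -!ev_xlift -!ev_ylift.
  by case: l => [[] []] //=; rewrite (invE _ _ (nzx false) (nzx true))
      || rewrite (invE _ _ (nzy false) (nzy true)).
case: l => [[] e]; rewrite /letter_num /letter_den /=; apply: specializes_ratio => //.
  rewrite !red_ylift !bmul_liftr -!rmorphM /=; congr (_ ^:P).
  by case: e => /=; ring.
rewrite !red_xlift !skmulCl -!mul_polyC -!polyCM; congr (_ %:P).
by case: e => /=; ring.
Qed.

Lemma word_den_central w P :
  bmul (word_den N1 N2 w) P = bmul P (word_den N1 N2 w).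
Proof.
elim: w P => [|l w IH] P /=; first by rewrite skmul1l skmul1r.
by rewrite -skmulA IH skmulA letter_den_central // -skmulA -IH.
Qed.

Lemma specializes_word w :
  specializes (word_eval u v w) (word_num N1 N2 w) (word_den N1 N2 w).
Proof.
elim: w => [|l w IH]; rewrite /word_eval.
  by rewrite big_nil; exists 1, 1; rewrite mul1r rmorph1 oner_neq0.
rewrite big_cons; apply: specializesM IH; first exact: word_den_central.
exact: specializes_letter.
Qed.

(** If a reduced word were 1, [specializes1] would equate its numerator and denominator at Z = -1,
    which [word_num_neq_den] excludes once a letter over X occurs. *)
Lemma quantum_free_pair : free_pair u v.
Proof.
have wordN1 w : reduced_word w -> has (fun l => ~~ l.1) w -> word_eval u v w != 1.
  move=> redw hasu; apply/eqP => e; have := specializes_word w; rewrite e => /specializes1.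
  exact: (word_num_neq_den k2).
have unitE (R : {poly kzx}) : red R != 0 -> ev R \is a GRing.unit.
  by move=> nzR; rewrite divD ?ev_neq0 ?red_neq0.
have uU : u \is a GRing.unit.
  rewrite /u /odd_ratio -!ev_xlift unitrMr ?unitrV unitE // red_xlift polyC_eq0.
    exact: (nz_sgn_twist true).
  exact: (nz_sgn_twist false).
have vU : v \is a GRing.unit.
  rewrite /v /odd_ratio -!ev_ylift unitrMr ?unitrV unitE // red_ylift map_polyC_eq0.
    exact: (nz_sgn_twist true).
  exact: (nz_sgn_twist false).
split=> // w nzw redw; have [hasu|/hasPn nou] := boolP (has (fun l => ~~ l.1) w).
  exact: wordN1.
(* A power of v is conjugated by u. *)
have : word_eval u v ((false, false) :: rcons w (false, true)) != 1.
  apply: wordN1 => //; case: w nzw redw nou => // l w _ redw nou.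
  have l1 : l.1 by have := nou l (mem_head _ _); rewrite negbK.
  rewrite /= {1}l1 /=; elim: w l redw nou l1 => [|l' w IH] l /=; first by move=> _ _ ->.
  move=> /andP[-> redw] nou l1 /=; apply: IH => // [x xw|].
    by apply: nou; rewrite inE xw orbT.
  by have := nou l'; rewrite !inE eqxx orbT negbK => ->.
apply: contraNneq => e; rewrite /word_eval big_cons -cats1 big_cat big_seq1 /= -/(word_eval u v w) e.
by rewrite mul1r divrr.
Qed.
End QuantumPlane.

(** * Torsion-free nilpotent groups with involution *)

Section GroupInvolution.
Variables (G : Type) (mul : G -> G -> G) (one : G) (inv : G -> G).
Hypothesis hG : is_group mul one inv.
Local Infix "**" := mul (at level 40, left associativity).
Local Notation gcom := (gcomm mul inv).

Let gA a b c : a ** b ** c = a ** (b ** c). Proof. by case: hG. Qed.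
Let g1l a : one ** a = a. Proof. by case: hG. Qed.
Let g1r a : a ** one = a. Proof. by case: hG. Qed.
Let gVl a : inv a ** a = one. Proof. by case: hG. Qed.
Let gVr a : a ** inv a = one. Proof. by case: hG. Qed.
Let gVKl a b : inv a ** (a ** b) = b. Proof. by rewrite -gA gVl g1l. Qed.
Let gKVl a b : a ** (inv a ** b) = b. Proof. by rewrite -gA gVr g1l. Qed.

Lemma group_mulIl a b c : a ** b = a ** c -> b = c.
Proof. by move=> e; rewrite -(gVKl a b) e gVKl. Qed.

Lemma group_mulIr a b c : b ** a = c ** a -> b = c.
Proof. by move=> e; rewrite -(g1r b) -(gVr a) -gA e gA gVr g1r. Qed.

Let g1V : inv one = one. Proof. by rewrite -(g1l (inv one)) gVr. Qed.
Let gVK a : inv (inv a) = a. Proof. by apply: (@group_mulIl (inv a)); rewrite gVl gVr. Qed.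
Let gVM a b : inv (a ** b) = inv b ** inv a.
Proof. by apply: (@group_mulIl (a ** b)); rewrite gVr gA gKVl gVr. Qed.
Let gE := (gVM, gVK, g1V, gA, g1l, g1r, gVl, gVr, gVKl, gKVl).

Definition gcentral c := forall g, c ** g = g ** c.

Lemma gcentralM c d : gcentral c -> gcentral d -> gcentral (c ** d).
Proof. by move=> hc hd g; rewrite gA hd -gA hc gA. Qed.

Lemma gcentralV c : gcentral c -> gcentral (inv c).
Proof.
by move=> hc g; apply: (@group_mulIl c); rewrite gKVl -gA hc gA gVr g1r.
Qed.

(** If all elements central modulo the center were central, the upper central series would stop at
    the center, and nilpotency would make the group abelian. *)
Lemma exists_second_center : nilpotent mul one inv -> nonabelian mul ->
  exists x, (forall y, gcentral (gcom x y)) /\ exists y, x ** y <> y ** x.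
Proof.
move=> [n nil] [a [b nab]].
have commE x y : gcom x y = one -> x ** y = y ** x.
  move=> e; apply: (@group_mulIl (inv x ** inv y)).
  by rewrite -/(gcomm mul inv x y) e !gE.
apply: NNPP => no.
have uc21 x : upper_central mul one inv 2 x -> upper_central mul one inv 1 x.
  move=> uc2 y; apply: NNPP => ne; apply: no; exists x; split.
    by move=> y' g; apply: commE; exact: uc2.
  by exists y => e; apply: ne; rewrite /gcomm e !gE.
have ucn1 m x : upper_central mul one inv m.+1 x -> upper_central mul one inv 1 x.
  elim: m x => // m IH x uc; apply: uc21 => y; apply: IH; exact: uc.
apply: nab; apply: commE; suff : upper_central mul one inv 1 a by apply.
case: n nil => [nil|n nil]; last exact: ucn1 (nil a).
by move=> y; exact: nil.
Qed.

Definition second_center x := forall y, exists2 c, gcentral c & x ** y = c ** (y ** x).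

Lemma second_centerM a b : second_center a -> second_center b -> second_center (a ** b).
Proof.
move=> ha hb y; have [c hc ec] := ha y; have [d hd ed] := hb y.
exists (d ** c); first exact: gcentralM.
by rewrite gA ed -gA -hd gA -(gA a) ec !gE.
Qed.

Lemma second_center_central c : gcentral c -> second_center c.
Proof. by move=> hc y; exists one => [g|]; rewrite !gE. Qed.

Hypothesis htf : torsion_free mul one.

Lemma torsion_free_sqr c : c ** c = one -> c = one.
Proof. by move=> e; apply: (htf (n := 2)) => //=; rewrite g1r. Qed.

Variable f : G -> G.
Hypotheses (fM : forall a b, f (a ** b) = f b ** f a) (fK : forall a, f (f a) = a).

Lemma involution1 : f one = one.
Proof. by apply: (@group_mulIl (f one)); rewrite -fM !gE. Qed.

Lemma involutionV a : f (inv a) = inv (f a).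
Proof. by apply: (@group_mulIl (f a)); rewrite -fM gVl gVr involution1. Qed.

Lemma involution_central c : gcentral c -> gcentral (f c).
Proof. by move=> hc g; rewrite -{1}(fK g) -fM -hc fM fK. Qed.

Lemma involution_second_center x : second_center x -> second_center (f x).
Proof.
move=> hx y; have [c hc ec] := hx (f y).
exists (f (inv c)); first by apply: involution_central; exact: gcentralV.
have : f y ** x = inv c ** (x ** f y) by rewrite ec !gE.
move/(congr1 f); rewrite !fM fK => ->.
by rewrite (involution_central (gcentralV hc)).
Qed.

(** If x f(x) is not central, it serves, being fixed by f. Otherwise d = x f(x) is central and fixed
    by f, and f inverts d^-1 x^2. *)
Lemma symmetric_second_center x : second_center x -> (exists y, x ** y <> y ** x) ->
  exists x', [/\ second_center x', exists y, x' ** y <> y ** x' & f x' = x' \/ f x' = inv x'].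
Proof.
move=> hx [y ne].
have [hd|nc] := classic (gcentral (x ** f x)); last first.
  exists (x ** f x); split; last by left; rewrite fM fK.
    by apply: second_centerM => //; exact: involution_second_center.
  by apply: not_all_ex_not.
have [d ed] : exists d, d = x ** f x by eexists.
rewrite -ed in hd; have fx : f x = inv x ** d by rewrite ed !gE.
have fd : f d = d by rewrite ed fM fK.
have hdV := gcentralV hd.
exists (inv d ** (x ** x)); split.
- by do !apply: second_centerM => //; exact: second_center_central.
- exists y => e; apply: ne; have [c hc ec] := hx y.
  have e2 : x ** (x ** y) = y ** (x ** x).
    by apply: (@group_mulIl (inv d)); rewrite -!gA -hdV !gA in e *.
  (* Moving x^2 past y produces c^2, and there is no torsion. *)
  suff c1 : c = one by rewrite ec c1 g1l.
  apply: torsion_free_sqr; apply: (@group_mulIr (y ** (x ** x))).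
  by rewrite g1l -{2}e2 ec -(gA x) -hc !gA -[in RHS](gA x) ec !gE.
- by right; rewrite !fM involutionV fd fx !gE hd.
Qed.

(** The first candidate, f(y) y, is fixed by f. If it commutes with x, y is replaced by y f(y)^-1,
    whose commutation factor with x is c^2. This lowers the level of y^-1 f(y)^-1 in the upper
    central series, and level 0 means f(y) = y^-1. *)
Lemma symmetric_partner x y c i : f x = x \/ f x = inv x -> gcentral c -> c <> one ->
  x ** y = c ** (y ** x) -> upper_central mul one inv i (inv y ** inv (f y)) ->
  exists y' c', [/\ gcentral c', c' <> one, x ** y' = c' ** (y' ** x) & f y' = y' \/ f y' = inv y'].
Proof.
move=> fx; elim: i y c => [|i IH] y c hc nc ec uc.
  exists y, c; split=> //; right; apply: (@group_mulIr y); rewrite gVl.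
  by move/(congr1 inv): uc; rewrite !gE.
(* Applying f to the commutation relation gives e = f(c)^-1 if f(x) = x, and e = f(c) if f(x) =
   x^-1. *)
have [e he ee] : exists2 e, gcentral e & x ** f y = e ** (f y ** x).
  have hfc := involution_central hc; move/(congr1 f): ec; rewrite !fM.
  case: fx => -> e.
    by exists (inv (f c)); [exact: gcentralV | rewrite e -hfc !gE].
  exists (f c) => //; move/(congr1 (fun g => x ** g ** x)): e; rewrite !gE => ->.
  by rewrite -gA -hfc gA.
have [ec1|nec] := classic (e ** c = one); last first.
  exists (f y ** y), (e ** c); split=> //; first exact: gcentralM.
    by rewrite -gA ee !gA ec -(gA _ c) -hc !gE.
  by left; rewrite fM fK.
set al := inv (f y).
have eal : x ** al = c ** (al ** x).
  have eV : e = inv c by apply: (@group_mulIr c); rewrite gVl.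
  have e' : f y ** x = c ** (x ** f y) by rewrite ee eV gKVl.
  by apply: (@group_mulIl (f y)); rewrite -gA e' -(gA _ c) -hc /al !gE.
apply: (IH (y ** al) (c ** c)).
- exact: gcentralM.
- by move/torsion_free_sqr.
- by rewrite -gA ec !gA eal -(gA _ c) -hc !gE.
(* The element attached to y f(y)^-1 is the commutator of y^-1 f(y)^-1 with y. *)
- have := uc y; congr (upper_central mul one inv i _).
  by rewrite /gcomm fM /al involutionV fK !gE.
Qed.

Lemma exists_symmetric_pair : nilpotent mul one inv -> nonabelian mul ->
  exists a b c, [/\ gcentral c, c <> one, a ** b = c ** (b ** a),
    f a = a \/ f a = inv a & f b = b \/ f b = inv b].
Proof.
move=> nil nab; have [x [hx nc]] := exists_second_center nil nab.
have hx2 : second_center x.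
  by move=> y; exists (gcom x y) => //; rewrite hx /gcomm !gE.
have [x' [hx' [y ne] fx']] := symmetric_second_center hx2 nc.
have [c hc ec] := hx' y; have [n ucn] := nil.
have nc1 : c <> one by move=> c1; apply: ne; rewrite ec c1 g1l.
have [y' [c' [hc' nc' ec' fy']]] := symmetric_partner fx' hc nc1 ec (ucn _).
by exists x', y', c'.
Qed.
End GroupInvolution.

(** * Quantum planes inside D *)

(** A word in the squares is a word in x and y with every letter doubled, and doubling keeps words
    reduced. *)
Lemma free_pair_sqr (R : unitRingType) (x y : R) : free_pair x y -> free_pair (x ^+ 2) (y ^+ 2).
Proof.
move=> [ux uy fr]; split; rewrite ?unitrX //.
pose dbl (w : seq (bool * bool)) := flatten [seq [:: l; l] | l <- w].
have evE w : word_eval (x ^+ 2) (y ^+ 2) w = word_eval x y (dbl w).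
  elim: w => [|l w IH]; first by rewrite /word_eval !big_nil.
  move: IH; rewrite /word_eval /= !big_cons mulrA => ->; congr (_ * _).
  by case: l => [[] []]; rewrite /letter_eval /= ?expr2 // invrM.
move=> w nzw redw; rewrite evE; apply: fr; first by case: w nzw redw.
elim: w redw {nzw} => // l w IH; rewrite /dbl /= eqxx => redlw /=.
case: w redlw IH => [|l' w] /=; first by rewrite eqxx.
by move=> /andP[h redw] IH; rewrite eqxx h /=; exact: IH.
Qed.

Lemma horner_algE_wide (k : fieldType) (D : unitAlgType k) (a : D) (p : {poly k}) n :
  (size p <= n)%N -> horner_alg a p = \sum_(i < n) p`_i *: a ^+ i.
Proof.
move=> szp; rewrite /horner_alg /horner_morph (@horner_coef_wide _ n).
  by apply: eq_bigr => i _; rewrite coef_map /= mulr_algl.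
exact: leq_trans (size_poly _ _) szp.
Qed.

Lemma qevalE (k : fieldType) (D : unitAlgType k) (X Y Z : D) n (P : {poly {poly {poly k}}}) :
  (size P <= n)%N ->
  qeval X Y Z P = \sum_(i < n) (map_poly (horner_alg Z) P`_i).[X] * Y ^+ i.
Proof.
move=> szP; rewrite /qeval (@horner_coef_wide _ n); last exact: leq_trans (size_poly _ _) szP.
by apply: eq_bigr => i _; rewrite coef_map_id0 // map_poly0 horner0.
Qed.

(** * Rescaling the generators of a quantum plane *)

Section Rescaling.
Variables (k : fieldType) (D : unitAlgType k) (X Y Z : D).
Local Notation kzx := {poly {poly k}}.

Hypothesis qXYZ : quantum_plane X Y Z.

(** The substitution multiplies the coefficient of X^j by a(Z)^j, which is nonzero, so independence
    is preserved. *)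
Lemma quantum_plane_scaleX (a : {poly k}) : a != 0 -> quantum_plane (horner_alg Z a * X) Y Z.
Proof.
move=> nza; case: (qXYZ) => cXZ cYZ YX inj.
have cXp p : GRing.comm X (horner_alg Z p) by exact: comm_horner_alg.
split=> //.
- apply/commr_sym/commrM; last exact: commr_sym.
  by apply: comm_horner_alg.
- by rewrite mulrA (comm_horner_alg a cYZ) -mulrA YX !mulrA (comm_horner_alg a (commr_refl Z)).
move=> P eP; apply/polyP => l; rewrite coef0.
pose sc (c : kzx) := c \Po (a%:P * 'X).
have scE (c : kzx) : (map_poly (horner_alg Z) c).[horner_alg Z a * X]
    = (map_poly (horner_alg Z) (sc c)).[X].
  pose m := maxn (size c) (size (sc c)).
  rewrite !(@horner_coef_wide _ m); last 2 first.
    by apply: leq_trans (size_poly _ _) (leq_maxr _ _).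
    by apply: leq_trans (size_poly _ _) (leq_maxl _ _).
  apply: eq_bigr => i _; rewrite !coef_map /= coef_comp_scaleX rmorphM rmorphXn /=.
  by rewrite exprMn_comm ?mulrA //; apply: commr_sym.
have /polyP/(_ l) : map_poly sc P = 0.
  apply: inj; rewrite -[RHS]eP !(@qevalE _ _ _ _ _ (size P)) ?size_poly //.
    by apply: eq_bigr => i _; rewrite coef_map_id0 ?scE // /sc comp_poly0.
rewrite coef_map_id0 ?coef0; last by rewrite /sc comp_poly0.
move=> /polyP e; apply/polyP => j; have := e j; rewrite coef_comp_scaleX !coef0 => /eqP.
by rewrite mulf_eq0 expf_eq0 (negPf nza) andbF orbF => /eqP.
Qed.

Lemma quantum_plane_scaleY (h : kzx) : h != 0 ->
  quantum_plane X ((map_poly (horner_alg Z) h).[X] * Y) Z.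
Proof.
move=> nzh; case: (qXYZ) => cXZ cYZ YX inj.
have cXp : commr_rmorph (horner_alg Z) X by move=> p; exact: comm_horner_alg.
pose psi : {rmorphism kzx -> D} := horner_morph cXp.
have Yp c : Y * psi c = psi (qtwist k c) * Y := Y_psi qXYZ c.
rewrite -[_.[X]]/(psi h).
have cpsi c : GRing.comm Z (psi c).
  rewrite /psi /= /horner_morph horner_coef; apply: commr_sum => i _.
  by rewrite coef_map /=; apply: commrM; [exact: comm_horner_alg|exact/commrX/commr_sym].
split=> //.
- by apply/commr_sym/commrM => //; exact: commr_sym.
- have cX : psi h * X = X * psi h by rewrite -(psiX qXYZ) -!rmorphM mulrC.
  by rewrite -[LHS]mulrA YX !mulrA -(cpsi h) -!(mulrA Z) cX.
(* Moving all Y to the right in (h Y)^l leaves the product of h and its first l - 1 twists, a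
   nonzero polynomial. *)
pose hs l := iter l (fun g : kzx => h * qtwist k g) 1.
have hsE l : (psi h * Y) ^+ l = psi (hs l) * Y ^+ l.
  elim: l => [|l IH]; first by rewrite !expr0 rmorph1 mulr1.
  by rewrite exprS IH mulrA -(mulrA (psi h)) Yp mulrA -rmorphM -mulrA -exprS.
have nzhs l : hs l != 0.
  elim: l => [|l IH] /=; first exact: oner_neq0.
  by rewrite mulf_neq0 // (iter_rmorph_eq0 (@qtwist_inj k) 1).
move=> P eP; apply/polyP => l; rewrite coef0.
have /polyP/(_ l) : \poly_(l < size P) (P`_l * hs l) = 0.
  apply: inj; rewrite -[RHS]eP !(@qevalE _ _ _ _ _ (size P)) ?size_poly //.
  apply: eq_bigr => i _; rewrite coef_poly ltn_ord -[X in X * _]/(psi _) rmorphM.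
  by rewrite -mulrA -hsE.
rewrite coef_poly coef0; case: ltnP => [_ /eqP|/(nth_default 0)-> //].
by rewrite mulf_eq0 (negPf (nzhs l)) orbF => /eqP.
Qed.
End Rescaling.

(** * The quantum plane of two group elements with central commutator *)

Section GroupAlgebra.
Variables (k : fieldType) (D : unitAlgType k) (G : Type) (phi : G -> D).
Hypothesis phi_inj : group_algebra_embedding phi.

Lemma group_algebra_embedding_fin (T : finType) (c : T -> k) (g : T -> G) : injective g ->
  \sum_t c t *: phi (g t) = 0 -> forall t, c t = 0.
Proof.
move=> ginj e t; rewrite -[t]enum_rankK.
apply: (phi_inj (c := c \o enum_val) (g := g \o enum_val)).
  by apply: inj_comp ginj _; exact: enum_val_inj.
rewrite -[RHS]e [in RHS](reindex (fun i : 'I_#|T| => enum_val i)) //.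
by apply: onW_bij; exact: enum_val_bij.
Qed.

Lemma group_algebra_embedding_inj : injective phi.
Proof.
move=> a b e; apply: NNPP => ne.
pose g (i : bool) := if i then a else b.
have : (1 : k) = 0.
  have ginj : injective g by move=> [] [] //= e'; case: ne.
  apply: (@group_algebra_embedding_fin bool (fun i => if i then 1 else -1) g ginj _ true).
  by rewrite big_bool /= e scale1r scaleN1r subrr.
by move/eqP; rewrite oner_eq0.
Qed.

Variables (mul : G -> G -> G) (one : G) (inv : G -> G).
Hypotheses (hG : is_group mul one inv) (htf : torsion_free mul one).
Hypothesis (phiM : forall a b, phi (mul a b) = phi a * phi b) (phi1 : phi one = 1).

Lemma phi_gpow a n : phi (gpow mul one a n) = phi a ^+ n.
Proof. by elim: n => //= n IH; rewrite phiM IH exprS. Qed.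

Lemma phi_unit a : phi a \is a GRing.unit.
Proof.
apply/unitrP; exists (phi (inv a)); rewrite -!phiM.
by case: hG => _ _ _ -> ->; rewrite phi1.
Qed.

Lemma phiV a : phi (inv a) = (phi a)^-1.
Proof.
by apply: (mulrI (phi_unit a)); rewrite divrr ?phi_unit // -phiM; case: hG => _ _ _ _ ->.
Qed.

Variables a b c : G.
Hypotheses (cc : gcentral mul c) (nc1 : c <> one) (ab : mul a b = mul c (mul b a)).
Local Notation A := (phi a).
Local Notation B := (phi b).
Local Notation C := (phi c).

Lemma phi_exp_inj m n : C ^+ m = C ^+ n -> m = n.
Proof.
wlog lemn : m n / (m <= n)%N => [hw|].
  by have [/hw//|/ltnW/hw h e] := leqP m n; rewrite h.
rewrite -{1}(subnKC lemn) exprD -{1}[C ^+ m]mulr1 => /(mulrI (unitrX _ (phi_unit c))).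
rewrite -phi_gpow -phi1 => /group_algebra_embedding_inj/esym e.
apply/eqP; rewrite eqn_leq lemn leqNgt -subn_gt0; apply/negP => /htf/(_ e).
exact: nc1.
Qed.

Let cBC : GRing.comm B C. Proof. by rewrite /GRing.comm -!phiM cc. Qed.
Let cAC : GRing.comm A C. Proof. by rewrite /GRing.comm -!phiM cc. Qed.
Let AB : A * B = C * B * A. Proof. by rewrite -!phiM ab; congr phi; case: hG => ->. Qed.

Lemma expr_twist_r j : A * B ^+ j = C ^+ j * B ^+ j * A.
Proof.
elim: j => [|j IH]; first by rewrite !expr0 mulr1 !mul1r.
have cB : B ^+ j * C = C * B ^+ j by exact/commr_sym/commrX/commr_sym.
by rewrite [B ^+ j.+1]exprSr mulrA IH -mulrA AB !mulrA -(mulrA (C ^+ j)) cB mulrA -exprSr.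
Qed.

Lemma expr_twist_l l : A ^+ l * B = C ^+ l * B * A ^+ l.
Proof.
elim: l => [|l IH]; first by rewrite !expr0 mulr1 !mul1r.
have cA : A * C ^+ l = C ^+ l * A by exact: commrX.
rewrite [A ^+ l.+1]exprS -mulrA IH !mulrA cA -(mulrA _ A B) AB !mulrA -exprSr.
by rewrite -!mulrA.
Qed.

Let mon i j l := C ^+ i * B ^+ j * A ^+ l.

(** Moving a monomial past A costs C^j and past B costs C^l. The powers of C are distinct, so these
    factors determine j and l, and then i follows by cancellation. *)
Lemma heisenberg_monomial_inj i j l i' j' l' :
  mon i j l = mon i' j' l' -> [/\ i = i', j = j' & l = l'].
Proof.
have uA := phi_unit a; have uB := phi_unit b; have uC := phi_unit c.
have umon p q r : mon p q r \is a GRing.unit by rewrite !unitrMl ?unitrX.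
have cA n : A * C ^+ n = C ^+ n * A by exact: commrX.
have cB n m : B ^+ m * C ^+ n = C ^+ n * B ^+ m.
  by apply: commrX; exact/commr_sym/commrX/commr_sym.
have monA p q r : A * mon p q r = C ^+ q * (mon p q r * A).
  rewrite /mon !mulrA cA -(mulrA _ A) expr_twist_r !mulrA -!exprD addnC.
  by rewrite -!mulrA -exprS -exprSr.
have monB p q r : mon p q r * B = C ^+ r * (B * mon p q r).
  have -> : B * mon p q r = C ^+ p * (B ^+ q * B) * A ^+ r.
    by rewrite /mon !mulrA -{1}[B]expr1 cB expr1 -(mulrA _ B) -exprS exprSr !mulrA.
  rewrite /mon -mulrA expr_twist_l !mulrA -(mulrA _ (B ^+ q) (C ^+ r)) cB !mulrA -!exprD.
  by rewrite addnC.
move=> e.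
have ej : j = j'.
  apply: phi_exp_inj; apply: (mulIr (x := mon i j l * A)); first by rewrite unitrMl.
  by rewrite -monA {2}e -monA e.
have el : l = l'.
  apply: phi_exp_inj; apply: (mulIr (x := B * mon i j l)); first by rewrite unitrMl.
  by rewrite -monB {2}e -monB e.
split=> //; apply: phi_exp_inj; move: e; rewrite /mon ej el.
by move/(mulIr (unitrX _ uA))/(mulIr (unitrX _ uB)).
Qed.

(** The ordered monomials are images of distinct elements of G, hence independent in the group
    algebra. *)
Lemma heisenberg_quantum_plane : quantum_plane B A C.
Proof.
split=> // P eP.
pose m1 := (\max_(l < size P) size (P`_l)%R)%N.
pose m2 := (\max_(l < size P) \max_(j < m1) size (P`_l`_j)%R)%N.
(* A common bound for the degrees in all three variables, so that triples of exponents form one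
   finite index type. *)
pose n := maxn (size P) (maxn m1 m2).
have sz0 : (size P <= n)%N by rewrite leq_maxl.
have sz1 l : (size (P`_l)%R <= m1)%N.
  have [ltl|lel] := ltnP l (size P); last by rewrite nth_default // size_poly0.
  by rewrite (bigmax_sup (Ordinal ltl)).
have sz2 l j : (size (P`_l`_j)%R <= m2)%N.
  have [ltl|lel] := ltnP l (size P); last by rewrite [P`_l]nth_default // coef0 size_poly0.
  have [ltj|lej] := ltnP j m1.
    by rewrite (bigmax_sup (Ordinal ltl)) // (bigmax_sup (Ordinal ltj)).
  by rewrite nth_default ?size_poly0 // (leq_trans (sz1 l)).
have {sz1} sz1 l : (size (P`_l)%R <= n)%N.
  by rewrite (leq_trans (sz1 l)) // /n !leq_max leqnn orbT.
have {sz2} sz2 l j : (size (P`_l`_j)%R <= n)%N.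
  by rewrite (leq_trans (sz2 l j)) // /n !leq_max leqnn !orbT.
pose T := ('I_n * ('I_n * 'I_n))%type.
pose co (t : T) : k := P`_t.1`_t.2.1`_t.2.2.
pose pw := gpow mul one.
pose g (t : T) := mul (mul (pw c t.2.2) (pw b t.2.1)) (pw a t.1).
have phig t : phi (g t) = mon t.2.2 t.2.1 t.1 by rewrite !phiM !phi_gpow.
have ginj : injective g.
  move=> t t' /(congr1 phi); rewrite !phig => /heisenberg_monomial_inj[].
  by case: t t' => [l [j i]] [l' [j' i']] /= /val_inj-> /val_inj-> /val_inj->.
have co0 : forall t, co t = 0.
  apply: (group_algebra_embedding_fin ginj); rewrite -[RHS]eP (@qevalE _ _ _ _ _ n) //.
  rewrite -(pair_bigA _ (fun l p => co (l, p) *: phi (g (l, p)))) /=.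
  apply: eq_bigr => l _; rewrite (@horner_coef_wide _ n); last first.
    exact: leq_trans (size_poly _ _) (sz1 l).
  rewrite mulr_suml -(pair_bigA _ (fun j i => co (l, (j, i)) *: phi (g (l, (j, i))))) /=.
  apply: eq_bigr => j _; rewrite coef_map /= (horner_algE_wide _ (sz2 l j)) !mulr_suml.
  by apply: eq_bigr => i _; rewrite phig -!scalerAl.
apply/polyP => l; apply/polyP => j; apply/polyP => i; rewrite !coef0.
have [ltl|lel] := ltnP l n; last first.
  by rewrite [P`_l]nth_default ?coef0 // (leq_trans sz0).
have [ltj|lej] := ltnP j n; last first.
  by rewrite [P`_l`_j]nth_default ?coef0 // (leq_trans (sz1 l)).
have [lti|lei] := ltnP i n; last by rewrite nth_default // (leq_trans (sz2 l j)).
exact: (co0 (Ordinal ltl, (Ordinal ltj, Ordinal lti))).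
Qed.
End GroupAlgebra.

(** * Symmetric and unitary elements *)

Section OddRatios.
Variables (k : fieldType) (D : unitAlgType k).
Hypothesis k2 : (2 : k) != 0.
Hypothesis divD : is_division_ring D.
Local Notation nt := (ntwist k).

Definition lin_odd : {poly k} := 1 - 'X.
(** This N satisfies N(1/t) = -t^-2 N(-t), so t |-> 1/t inverts N(t)/N(-t). *)
Definition quad_odd : {poly k} := 1 + 'X - 'X^2.

Lemma nt_lin_odd : nt lin_odd = 1 + 'X.
Proof. by rewrite rmorphB rmorph1 /ntwist /= comp_polyX opprK. Qed.

Lemma nt_quad_odd : nt quad_odd = 1 - 'X - 'X^2.
Proof. by rewrite rmorphB rmorphD rmorph1 rmorphXn /ntwist /= comp_polyX sqrrN. Qed.

Lemma eqp_two : (2 : {poly k}) %= 1.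
Proof. by rewrite -size_poly_eq1 -polyC_natr size_polyC k2. Qed.

Lemma coprime_lin_odd : coprimep lin_odd (nt lin_odd).
Proof.
rewrite nt_lin_odd; apply/Bezout_coprimepP; exists (1, 1) => /=.
by rewrite /lin_odd (_ : _ + _ = 2) ?eqp_two //; ring.
Qed.

Lemma coprime_quad_odd : coprimep quad_odd (nt quad_odd).
Proof.
(* (1 + t)(1 + t - t^2) + (1 - t)(1 - t - t^2) = 2. *)
rewrite nt_quad_odd; apply/Bezout_coprimepP; exists (1 + 'X, 1 - 'X) => /=.
by rewrite /quad_odd (_ : _ + _ = 2) ?eqp_two //; ring.
Qed.

Lemma size_lin_odd : (1 < size lin_odd)%N.
Proof.
rewrite ltnNge; apply/negP => /leq_sizeP/(_ 1 isT)/eqP.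
by rewrite coefB coef1 coefX sub0r oppr_eq0 oner_eq0.
Qed.

Lemma size_quad_odd : (1 < size quad_odd)%N.
Proof.
rewrite ltnNge; apply/negP => /leq_sizeP/(_ 1 isT)/eqP.
by rewrite coefB coefD coef1 coefX coefXn add0r subr0 oner_eq0.
Qed.

(** Zero values are included thanks to 0^-1 = 0. *)
Lemma division_ring_invf_div (a b : D) : (a / b)^-1 = b / a.
Proof.
have invr0D : (0 : D)^-1 = 0 by rewrite invr_out // unitr0.
have [->|/divD ua] := eqVneq a 0; first by rewrite mul0r invr0D mulr0.
have [->|/divD ub] := eqVneq b 0; first by rewrite invr0D mulr0 invr0D mul0r.
by rewrite invrM ?unitrV // invrK.
Qed.

Lemma odd_ratioN N (x : D) : odd_ratio N (- x) = (odd_ratio N x)^-1.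
Proof.
have hN p : horner_alg (- x) p = horner_alg x (nt p).
  rewrite !(@horner_algE_wide _ _ _ _ (size p)) ?size_ntwist //.
  apply: eq_bigr => i _; rewrite coef_ntwist (exprNn x) -scalerA; congr (_ *: _).
  rewrite -(signr_odd D i) -(signr_odd k i).
  by case: (odd i); rewrite ?expr1 ?expr0 ?mulN1r ?scaleN1r ?mul1r ?scale1r.
by rewrite /odd_ratio division_ring_invf_div !hN ntwistK.
Qed.

Lemma division_ring_divMr (a b c : D) : c \is a GRing.unit -> (a * c) / (b * c) = a / b.
Proof.
move=> uc; have [->|/divD ub] := eqVneq b 0; first by rewrite mul0r invr_out ?unitr0 // !mulr0.
by rewrite invrM // mulrA mulrK.
Qed.

Lemma lin_odd_ratioV (x : D) : x \is a GRing.unit ->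
  odd_ratio lin_odd x^-1 = - odd_ratio lin_odd x.
Proof.
move=> ux; rewrite /odd_ratio nt_lin_odd /lin_odd !rmorphB !rmorphD !rmorph1 /= !horner_algX.
rewrite -[RHS]mulNr -(division_ring_divMr (- (1 - x)) _ (c := x^-1)) ?unitrV //.
by congr (_ / _); [rewrite opprB mulrBl | rewrite mulrDl addrC]; rewrite divrr ?mul1r.
Qed.

Lemma quad_odd_ratioV (x : D) : x \is a GRing.unit ->
  odd_ratio quad_odd x^-1 = (odd_ratio quad_odd x)^-1.
Proof.
move=> ux; rewrite /odd_ratio nt_quad_odd /quad_odd division_ring_invf_div.
rewrite !rmorphB !rmorphD !rmorph1 !rmorphXn /= !horner_algX.
set w := x^-1; rewrite -[RHS](@division_ring_divMr _ _ (- w ^+ 2)); last first.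
  by rewrite unitrN unitrX // unitrV.
have e1 : x * w ^+ 2 = w by rewrite expr2 mulrA divrr ?mul1r.
have e2 : x ^+ 2 * w ^+ 2 = 1 by rewrite expr2 -mulrA e1 divrr.
congr (_ / _).
  by rewrite mulrN !mulrBl mul1r e1 e2 !opprB addrA.
by rewrite mulrN mulrBl mulrDl mul1r e1 e2 opprB opprD addrA addrAC.
Qed.

Variable s : D -> D.
Hypothesis hs : k_involution s.

Lemma kinvolD x y : s (x + y) = s x + s y.
Proof. by case: hs => h _ _; rewrite -[x]scale1r h !scale1r. Qed.
Lemma kinvol0 : s 0 = 0.
Proof. by apply: (@addrI _ (s 0)); rewrite -kinvolD !addr0. Qed.
Lemma kinvolZ (a : k) x : s (a *: x) = a *: s x.
Proof. by case: hs => h _ _; rewrite -[a *: x]addr0 h kinvol0 addr0. Qed.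
Lemma kinvolN x : s (- x) = - s x.
Proof. by rewrite -scaleN1r kinvolZ scaleN1r. Qed.
Lemma kinvolM x y : s (x * y) = s y * s x.
Proof. by case: hs. Qed.
Lemma kinvolK x : s (s x) = x.
Proof. by case: hs. Qed.
Lemma kinvol1 : s 1 = 1.
Proof. by rewrite -[LHS]mulr1 -{2}[1]kinvolK -kinvolM mulr1 kinvolK. Qed.
Lemma kinvolX x n : s (x ^+ n) = s x ^+ n.
Proof. by elim: n => [|n IH]; rewrite ?kinvol1 // exprS kinvolM IH exprSr. Qed.

Lemma kinvolV x : s x^-1 = (s x)^-1.
Proof.
have [->|/divD ux] := eqVneq x 0; first by rewrite invr_out ?unitr0 // kinvol0 invr_out ?unitr0.
have e1 : s x * s x^-1 = 1 by rewrite -kinvolM mulVr // kinvol1.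
have e2 : s x^-1 * s x = 1 by rewrite -kinvolM divrr // kinvol1.
have usx : s x \is a GRing.unit by apply/unitrP; exists (s x^-1).
by apply: (mulrI usx); rewrite e1 divrr.
Qed.

Lemma involution_horner x p : s (horner_alg x p) = horner_alg (s x) p.
Proof.
rewrite !(@horner_algE_wide _ _ _ _ (size p)) //.
elim/big_rec2: _ => [|i y1 y2 _ <-]; first exact: kinvol0.
by rewrite kinvolD kinvolZ kinvolX.
Qed.

(** The involution reverses the quotient, but both of its terms are polynomials in the same element
    and commute. *)
Lemma involution_odd_ratio N x : s (odd_ratio N x) = odd_ratio N (s x).
Proof.
rewrite /odd_ratio kinvolM kinvolV !involution_horner.
have c : GRing.comm (horner_alg (s x) N) (horner_alg (s x) (nt N)).
  by rewrite /GRing.comm -!rmorphM mulrC.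
by rewrite -(commrV c).
Qed.

Lemma unitary_of_inv u : u \is a GRing.unit -> s u = u^-1 -> unitary s u.
Proof. by move=> uu e; rewrite /unitary e divrr ?mulVr. Qed.

Lemma symmetric_lin_odd_sqr x : x \is a GRing.unit -> s x = x \/ s x = x^-1 ->
  s (odd_ratio lin_odd x ^+ 2) = odd_ratio lin_odd x ^+ 2.
Proof.
move=> ux sx; rewrite kinvolX involution_odd_ratio.
by case: sx => -> //; rewrite lin_odd_ratioV // sqrrN.
Qed.
End OddRatios.

(** * Free unitary pairs, according to the action of the involution on X and Y *)

Section HeisenbergUnitary.
Variables (k : fieldType) (D : unitAlgType k).
Hypothesis k2 : (2 : k) != 0.
Hypothesis divD : is_division_ring D.
Variable s : D -> D.
Hypothesis hs : k_involution s.
Variables (G : Type) (phi : G -> D).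
Hypothesis phi_inj : group_algebra_embedding phi.
Variables (mul : G -> G -> G) (one : G) (inv : G -> G).
Hypotheses (hG : is_group mul one inv) (htf : torsion_free mul one).
Hypothesis (phiM : forall a b, phi (mul a b) = phi a * phi b) (phi1 : phi one = 1).
Variables a b c : G.
Hypotheses (cc : gcentral mul c) (nc1 : c <> one) (ab : mul a b = mul c (mul b a)).
Local Notation X := (phi b).
Local Notation Y := (phi a).
Local Notation Z := (phi c).

Let uX : X \is a GRing.unit. Proof. exact: (phi_unit hG phiM phi1). Qed.
Let uY : Y \is a GRing.unit. Proof. exact: (phi_unit hG phiM phi1). Qed.
Let uZ : Z \is a GRing.unit. Proof. exact: (phi_unit hG phiM phi1). Qed.
Let cZX : Z * X = X * Z. Proof. by rewrite -!phiM cc. Qed.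
Let cZY : Z * Y = Y * Z. Proof. by rewrite -!phiM cc. Qed.
Let YX : Y * X = Z * X * Y. Proof. by rewrite -!phiM ab !phiM mulrA. Qed.
Let sM x y : s (x * y) = s y * s x := kinvolM hs x y.

Lemma free_unitary_both_inverted : s X = X^-1 -> s Y = Y^-1 ->
  exists u v : D, free_unitary_pair s u v.
Proof.
move=> sX sY; have qp := heisenberg_quantum_plane phi_inj hG htf phiM phi1 cc nc1 ab.
have fr := quantum_free_pair k2 divD qp (coprime_quad_odd k2) (size_quad_odd k)
  (coprime_quad_odd k2) (size_quad_odd k).
exists (odd_ratio (quad_odd k) X), (odd_ratio (quad_odd k) Y); split=> //; case: fr => uu uv _.
  by apply: unitary_of_inv => //; rewrite involution_odd_ratio // sX quad_odd_ratioV.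
by apply: unitary_of_inv => //; rewrite involution_odd_ratio // sY quad_odd_ratioV.
Qed.

(* Y X - X^-1 Y is skew-symmetric and q-commutes with X. *)
Lemma free_unitary_one_inverted : s X = X^-1 -> s Y = Y ->
  exists u v : D, free_unitary_pair s u v.
Proof.
(* X^-1 Y satisfies the same relation with X as Y does, and (Z X^2 - 1) X^-1 Y = Y X - X^-1 Y. *)
move=> sX sY; pose a1 := mul (inv b) a.
have ab1 : mul a1 b = mul c (mul b a1).
  apply: (group_algebra_embedding_inj phi_inj).
  by rewrite !phiM (phiV hG phiM phi1) -mulrA YX mulVKr // cZX -mulrA mulKr.
have qp := heisenberg_quantum_plane phi_inj hG htf phiM phi1 cc nc1 ab1.
pose h : {poly {poly k}} := 'X%:P * 'X^2 - 1.
have nzh : h != 0.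
  apply/eqP => /polyP/(_ 0)/eqP; rewrite coefB coefCM coefXn coef1 coef0 mulr0 sub0r.
  by rewrite oppr_eq0 oner_eq0.
have {qp} := quantum_plane_scaleY qp nzh; set Y' := _ * phi a1 => qp.
have eY' : Y' = Y * X - X^-1 * Y.
  rewrite /Y' /h rmorphB rmorphM rmorph1 /= map_polyC map_polyXn /= horner_algX.
  rewrite hornerD hornerN hornerCM hornerXn hornerC phiM (phiV hG phiM phi1).
  by rewrite mulrBl mul1r expr2 !mulrA mulrK // YX.
have sY' : s Y' = - Y'.
  by rewrite eY' (kinvolD hs) (kinvolN hs) !sM (kinvolV divD hs) sX sY invrK opprB.
have fr := quantum_free_pair k2 divD qp (coprime_quad_odd k2) (size_quad_odd k)
  (coprime_lin_odd k2) (size_lin_odd k).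
exists (odd_ratio (quad_odd k) X), (odd_ratio (lin_odd k) Y'); split=> //; case: fr => uu uv _.
  by apply: unitary_of_inv => //; rewrite involution_odd_ratio // sX quad_odd_ratioV.
by apply: unitary_of_inv => //; rewrite involution_odd_ratio // sY' odd_ratioN.
Qed.

(* Here Z^* = Z^-1, so that (Z^-1 - Z) X and (Z^-1 - Z) Y are skew-symmetric. *)
Lemma free_unitary_both_fixed : s X = X -> s Y = Y ->
  exists u v : D, free_unitary_pair s u v.
Proof.
move=> sX sY.
have sZ : s Z = Z^-1.
  (* Applying [s] to Y X = Z X Y gives X Y = Y X s(Z). *)
  have := congr1 s YX; rewrite !sM sX sY => e.
  apply: (mulrI uZ); rewrite divrr //; apply: (mulrI (x := X * Y)); first by rewrite unitrMl.
  by rewrite mulr1 mulrA -(mulrA X) -cZY mulrA -cZX -YX -mulrA -e.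
(* Rescaling is by polynomials in Z, so Z^-1 is first put into the generators: (1 - Z^2) Z^-1 = Z^-1
   - Z. *)
pose a1 := mul (inv c) a; pose b1 := mul (inv c) b.
have phia1 : phi a1 = Z^-1 * Y by rewrite phiM (phiV hG phiM phi1).
have phib1 : phi b1 = Z^-1 * X by rewrite phiM (phiV hG phiM phi1).
have cV (x : D) : Z * x = x * Z -> Z^-1 * x = x * Z^-1.
  by move=> e; apply/esym/commrV/esym.
have ab1 : mul a1 b1 = mul c (mul b1 a1).
  apply: (group_algebra_embedding_inj phi_inj).
  rewrite (phiM a1 b1) (phiM c) (phiM b1 a1) phia1 phib1 -(mulrA _ X) mulVKr //.
  rewrite -mulrA (mulrA Y) -(cV Y) // -(mulrA _ Y) YX -(mulrA Z) mulKr //.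
  by rewrite mulrA (cV X) // -mulrA.
have qp0 := heisenberg_quantum_plane phi_inj hG htf phiM phi1 cc nc1 ab1.
pose al : {poly k} := 1 - 'X^2.
have nzal : al != 0.
  apply/eqP => /polyP/(_ 0)/eqP; rewrite coefB coefXn coef1 coef0 subr0.
  by rewrite oner_eq0.
have qp1 := quantum_plane_scaleX qp0 nzal.
have nzalC : al%:P != 0 :> {poly {poly k}} by rewrite polyC_eq0.
have := quantum_plane_scaleY qp1 nzalC; rewrite map_polyC hornerC /= => qp.
have alE : horner_alg Z al = 1 - Z ^+ 2 by rewrite rmorphB rmorph1 rmorphXn /= horner_algX.
have skew W : s W = W -> Z * W = W * Z ->
    s (horner_alg Z al * (Z^-1 * W)) = - (horner_alg Z al * (Z^-1 * W)).
  move=> sW cW; rewrite alE !sM sW (kinvolV divD hs) sZ invrK.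
  rewrite (kinvolD hs) (kinvolN hs) (kinvol1 hs) (kinvolX hs) sZ.
  rewrite mulrBr mulr1 expr2 mulrA mulrK // mulrBl mul1r expr2 -(mulrA Z) (mulrA Z Z^-1).
  by rewrite divrr // mul1r opprB (cV W) // cW.
have fr := quantum_free_pair k2 divD qp (coprime_lin_odd k2) (size_lin_odd k)
  (coprime_lin_odd k2) (size_lin_odd k).
exists (odd_ratio (lin_odd k) (horner_alg Z al * phi b1)),
  (odd_ratio (lin_odd k) (horner_alg Z al * phi a1)).
split=> //; case: fr => uu uv _; apply: unitary_of_inv => //; rewrite involution_odd_ratio //.
  by rewrite phib1 skew // odd_ratioN.
by rewrite phia1 skew // odd_ratioN.
Qed.
End HeisenbergUnitary.

Theorem theorem1p3
  (k : fieldType) (hk : (2 : k) != 0)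
  (G : Type) (mul : G -> G -> G) (one : G) (inv : G -> G)
  (hG : is_group mul one inv) (htf : torsion_free mul one)
  (hnil : nilpotent mul one inv) (hnab : nonabelian mul)
  (D : unitAlgType k) (hD : is_division_ring D)
  (phi : G -> D)
  (hphi_mul : forall a b, phi (mul a b) = phi a * phi b) (hphi_one : phi one = 1)
  (hphi_inj : group_algebra_embedding phi)
  (hOre : forall d : D, exists a b : D,
      [/\ in_group_algebra phi a, in_group_algebra phi b, b != 0 & d = a / b])
  (f : G -> G) (hf : group_involution mul f)
  (s : D -> D) (hs : k_involution s)
  (hsf : forall g, s (phi g) = phi (f g)) :
  (exists x y : D, free_symmetric_pair s x y) /\
  (exists u v : D, free_unitary_pair s u v).
Proof.
have [fM [fK _]] := hf.
have [a [b [c [cc nc1 ab fa fb]]]] := exists_symmetric_pair hG htf fM fK hnil hnab.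
have uphi := phi_unit hG hphi_mul hphi_one; have phiV := phiV hG hphi_mul hphi_one.
have s_of g : f g = g \/ f g = inv g -> s (phi g) = phi g \/ s (phi g) = (phi g)^-1.
  by rewrite hsf -phiV => -[] ->; [left|right].
split.
  have qp := heisenberg_quantum_plane hphi_inj hG htf hphi_mul hphi_one cc nc1 ab.
  have fr := quantum_free_pair hk hD qp (coprime_lin_odd hk) (size_lin_odd k)
    (coprime_lin_odd hk) (size_lin_odd k).
  (* [s] fixes each ratio or changes its sign, hence the squares. *)
  exists (odd_ratio (lin_odd k) (phi b) ^+ 2), (odd_ratio (lin_odd k) (phi a) ^+ 2).
  by split; [apply: symmetric_lin_odd_sqr|apply: symmetric_lin_odd_sqr|apply: free_pair_sqr];
    auto.
have [sb|sb] := s_of b fb; have [sa|sa] := s_of a fa.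
- exact: (free_unitary_both_fixed hk hD hs hphi_inj hG htf hphi_mul hphi_one cc nc1 ab).
(* The roles of a and b are exchanged, so that the inverted generator becomes X; this replaces c by
   its inverse. *)
- have ba : mul b a = mul (inv c) (mul a b).
    apply: (group_algebra_embedding_inj hphi_inj).
    by rewrite ab hphi_mul [in RHS]hphi_mul phiV hphi_mul mulKr // hphi_mul.
  have ncV : inv c <> one.
    by move=> e; apply: nc1; case: (hG) => _ g1l _ gVl _; rewrite -[LHS]g1l -e gVl.
  exact: (free_unitary_one_inverted hk hD hs hphi_inj hG htf hphi_mul hphi_one
    (gcentralV hG cc) ncV ba).
- exact: (free_unitary_one_inverted hk hD hs hphi_inj hG htf hphi_mul hphi_one cc nc1 ab).
- exact: (free_unitary_both_inverted hk hD hs hphi_inj hG htf hphi_mul hphi_one cc nc1 ab).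
Qed.
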